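(* Let $X_1$ and $X_2$ be two strongly causal and locally compact Lorentzian length spaces, and let $X := X_1\sqcup_A X_2$ be their Lorentzian amalgamation. Then $X$ is a Lorentzian length space, and moreover $X$ is strongly localizable.
   Context: Lorentzian pre-length spaces. A Lorentzian pre-length space is a tuple $(X,d,\ll,\leq,\tau)$, abbreviated $X$, where $d$ is a metric on $X$ (the value $\infty$ is allowed; all topological notions refer to $d$), $\leq$ is a reflexive and transitive relation on $X$, $\ll$ is a transitive relation contained in $\leq$, and $\tau: X\times X\to[0,\infty]$ is lower semi-continuous with respect to $d$, satisfies $\tau(x,z)\geq\tau(x,y)+\tau(y,z)$ whenever $x\leq y\leq z$, and $\tau(x,y)>0 \iff x\ll y$. Notation: $I^+(x)=\{y\mid x\ll y\}$, $I^-(x)=\{y\mid y\ll x\}$, $I(x,y)=I^+(x)\cap I^-(y)$. Conventions: $\inf\emptyset=\infty$, $\sup\emptyset=0$. Curves. A (future-directed) causal (respectively timelike) curve is a locally Lipschitz curve $\gamma:[a,b]\to X$ with $\gamma(s)\leq\gamma(t)$ (respectively $\gamma(s)\ll\gamma(t)$) for all $s<t$ in $[a,b]$. Its $\tau$-length is $L_\tau(\gamma)=\inf\{\sum_{i=0}^{n-1}\tau(\gamma(t_i),\gamma(t_{i+1}))\mid a=t_0<t_1<\dots<t_n=b,\ n\in\mathbb N\}$; $L_d(\gamma)$ is the usual length with respect to $d$. Properties of a Lorentzian pre-length space $X$. - Strongly causal: $\{I(x,y)\mid x,y\in X\}$ is a subbasis for the metric topology of $X$. - Causally path-connected: $x\ll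 y$ implies there is a timelike curve from $x$ to $y$, and $x\leq y$ implies there is a causal curve from $x$ to $y$. - Locally causally closed: every point has a causally closed neighbourhood $U$, meaning: for all sequences $(p_n),(q_n)$ in $U$ with $p_n\leq q_n$ for all $n$ and $p_n\to p\in\overline U$, $q_n\to q\in\overline U$, one has $p\leq q$. - Intrinsic: $\tau(x,y)=\sup\{L_\tau(\gamma)\mid\gamma\text{ is a future-directed causal curve from }x\text{ to }y\}$ for all $x,y$. - Localizable: every point has a localizable neighbourhood, i.e. a neighbourhood $U$ such that (1) there is $C>0$ with $L_d(\gamma)\leq C$ for all causal curves $\gamma$ contained in $U$; (2) there is a continuous map $\omega_U:U\times U\to[0,\infty)$ such that $(U,d|_{U\times U},\ll|_{U\times U},\leq|_{U\times U},\omega_U)$ is a Lorentzian pre-length space and $I^{+}(p)\cap U\neq\emptyset$, $I^-(p)\cap U\neq\emptyset$ for all $p\in U$; (3) for all $p,q\in U$ with $p\leq q$ there is a causal curve $\gamma$ from $p$ to $q$ contained in $U$ which is maximal in $U$ (its $\tau$-length is at least that of every causal curve from $p$ to $q$ contained in $U$) and satisfies $L_\tau(\gamma)=\omega_U(p,q)$. Strongly localizable: every point has a neighbourhood basis of localizable neighbourhoods. - A Lorentzian length space is a locally causally closed, causally path-connected, localizable and intrinsic Lorentzian pre-length space. Amalgamation. A subset $A$ of a Lorentzian pre-length space $X$ is non-future locally isolating if for all $a\in A$ with $I^+(a)\neq\emptyset$ and all neighbourhoods $U$ of $a$ in $X$ there is $b_+\in U\cap A$ with $a\ll b_+$; non-past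 locally isolating is defined analogously (with $I^-(a)\neq\emptyset$ and $b_-\ll a$); $A$ is non-timelike locally isolating if both hold. Let $(X_i,d_i,\ll_i,\leq_i,\tau_i)$, $i=1,2$, be Lorentzian pre-length spaces, let $A_i\subseteq X_i$ be closed and non-timelike locally isolating, and let $f:A_1\to A_2$ be a locally bi-Lipschitz homeomorphism (every $a\in A_1$ has a neighbourhood $U\subseteq A_1$ such that $f|_U:U\to f(U)$ and its inverse are Lipschitz) such that for all $a\in A_1$ and each sign, $I_1^{\pm}(a)\neq\emptyset\iff I_2^{\pm}(f(a))\neq\emptyset$. Standing assumption: $f$ is $\tau$-preserving and $\leq$-preserving, i.e. $\tau_1(a,b)=\tau_2(f(a),f(b))$ and $a\leq_1 b\iff f(a)\leq_2 f(b)$ for all $a,b\in A_1$. On $X_1\sqcup X_2$ let $d=d_i$, $\tau=\tau_i$ on $X_i\times X_i$ and $d=\infty$, $\tau=0$ for points of different spaces, $\leq\,:=\,\leq_1\sqcup\leq_2$, $\ll\,:=\,\ll_1\sqcup\ll_2$. Let $\sim$ be the equivalence relation generated by $a\sim f(a)$, $a\in A_1$. The Lorentzian amalgamation $X_1\sqcup_A X_2$ is $((X_1\sqcup X_2)/\sim,\widetilde d,\widetilde\ll,\widetilde\leq,\widetilde\tau)$, where $\widetilde\tau([x],[y])=\sup\{\sum_{i=1}^n\tau(x_i,y_i)\mid x\sim x_1\leq y_1\sim x_2\leq y_2\sim\dots\sim x_n\leq y_n\sim y,\ n\in\mathbb N\}$, $[x]\,\widetilde\ll\,[y]$ iff $\widetilde\tau([x],[y])>0$,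 $[x]\,\widetilde\leq\,[y]$ iff the set in this supremum is nonempty, and $\widetilde d([x],[y])=\inf\{\sum_{i=1}^n d(x_i,y_i)\mid x\sim x_1,\ x_{i+1}\sim y_i,\ y_n\sim y,\ n\in\mathbb N\}$. In this setting $X_1\sqcup_A X_2$ is a Lorentzian pre-length space. *)

(* Defs.v *)
From HB Require Import structures.
From Stdlib Require Relation_Operators.
From mathcomp Require Import all_boot all_order all_algebra generic_quotient.
From mathcomp Require Import all_classical all_reals all_analysis.
Import Order.TTheory GRing.Theory Num.Theory.
Import numFieldNormedType.Exports.

Set Implicit Arguments.
Unset Strict Implicit.
Unset Printing Implicit Defensive.

Local Open Scope classical_set_scope.
Local Open Scope ring_scope.
Local Open Scope ereal_scope.
Local Open Scope quotient_scope.

(* The tuple (X, d, <<, <=, tau) without its axioms, which are collected in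
   [lorentzian_prelength] below.  Keeping data and axioms apart lets the
   amalgamation be defined without first proving that its distance is a metric
   and that its time separation function is lower semicontinuous. *)
Record lorentz_data (R : realType) : Type := LorentzData {
  lcar :> Type;
  ldist : lcar -> lcar -> \bar R;
  chron : lcar -> lcar -> Prop;
  caus : lcar -> lcar -> Prop;
  tsep : lcar -> lcar -> \bar R }.

Arguments ldist {R} _ _ _.
Arguments chron {R} _ _ _.
Arguments caus {R} _ _ _.
Arguments tsep {R} _ _ _.

HB.instance Definition _ (R : realType) (X : lorentz_data R) :=
  gen_eqMixin (lcar X).
HB.instance Definition _ (R : realType) (X : lorentz_data R) :=
  gen_choiceMixin (lcar X).

(* The topology induced by d: a set is open iff it contains a d-ball around
   each of its points.  This is a topology for an arbitrary function d, and the
   metric topology as soon as d is a (possibly infinite) metric. *)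
Section MetricTopology.
Context {R : realType} (X : lorentz_data R).

Definition dopen (A : set (lcar X)) : Prop := forall x, A x ->
  exists2 e : R, (0 < e)%R & forall y, ldist X x y < e%:E -> A y.

Lemma dopenT : dopen setT.
Proof. by move=> x _; exists 1%R. Qed.

Lemma dopenI : setI_closed dopen.
Proof.
move=> A B oA oB x [/oA[e e0 eA] /oB[e' e'0 e'B]].
exists (Num.min e e'); first by rewrite lt_min e0.
move=> y /lt_le_trans yx; split; [apply: eA|apply: e'B]; apply: yx;
  by rewrite lee_fin ge_min lexx ?orbT.
Qed.

Lemma dopen_bigU (I : Type) (F : I -> set (lcar X)) :
  (forall i, dopen (F i)) -> dopen (\bigcup_i F i).
Proof.
move=> oF x [i _ /oF[e e0 eF]]; exists e => // y /eF Fy.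
by exists i.
Qed.

HB.instance Definition _ :=
  isOpenTopological.Build (lcar X) dopenT dopenI dopen_bigU.

End MetricTopology.

Record lorentzian_prelength (R : realType) (X : lorentz_data R) : Prop := {
  ldist_ge0 : forall x y : X, 0 <= ldist X x y;
  ldist_eq0 : forall x y : X, ldist X x y = 0 <-> x = y;
  ldist_sym : forall x y : X, ldist X x y = ldist X y x;
  ldist_triangle : forall x y z : X,
    ldist X x z <= ldist X x y + ldist X y z;
  caus_refl : forall x : X, caus X x x;
  caus_trans : forall x y z : X, caus X x y -> caus X y z -> caus X x z;
  chron_trans : forall x y z : X, chron X x y -> chron X y z -> chron X x z;
  chron_caus : forall x y : X, chron X x y -> caus X x y;
  tsep_ge0 : forall x y : X, 0 <= tsep X x y;
  tsep_lsc : lower_semicontinuous (fun p : X * X => tsep X p.1 p.2);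
  tsep_reverse_triangle : forall x y z : X, caus X x y -> caus X y z ->
    tsep X x y + tsep X y z <= tsep X x z;
  tsep_gt0 : forall x y : X, 0 < tsep X x y <-> chron X x y }.

(* Supremum of a set of values in [0, +oo], with sup set0 = 0
   ([ereal_sup set0] is -oo). *)
Definition esup0 (R : realType) (S : set (\bar R)) : \bar R :=
  ereal_sup (0 |` S).

Section LorentzianNotions.
Context {R : realType} (X : lorentz_data R).
Implicit Types (x y p q : X) (U A : set X) (a b : R) (g : R -> X).

Definition future x : set X := [set y | chron X x y].
Definition past x : set X := [set y | chron X y x].
Definition diamond x y : set X := future x `&` past y.

(* A curve [a, b] -> X, a < b, is a function on R of which only the values on
   [a, b] are ever used; constant curves are allowed. *)
Definition locally_lipschitz_curve a b g : Prop :=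
  forall t, t \in `[a, b] -> exists2 e : R, (0 < e)%R & exists L : R,
    forall s s', s \in `[a, b] -> s' \in `[a, b] ->
      (`|s - t| < e)%R -> (`|s' - t| < e)%R ->
      ldist X (g s) (g s') <= (L * `|s - s'|)%:E.

Definition curve_monotone (r : X -> X -> Prop) a b g : Prop :=
  forall s t, s \in `[a, b] -> t \in `[a, b] -> (s < t)%R -> r (g s) (g t).

Definition causal_curve a b g : Prop :=
  [/\ (a < b)%R, locally_lipschitz_curve a b g &
      curve_monotone (caus X) a b g].

Definition timelike_curve a b g : Prop :=
  [/\ (a < b)%R, locally_lipschitz_curve a b g &
      curve_monotone (chron X) a b g].

Definition causal_curve_between x y a b g : Prop :=
  [/\ causal_curve a b g, g a = x & g b = y].

Definition timelike_curve_between x y a b g : Prop :=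
  [/\ timelike_curve a b g, g a = x & g b = y].

Definition curve_in U a b g : Prop := forall t, t \in `[a, b] -> U (g t).

(* The sum of h (g t_i) (g t_(i+1)) over the subdivision a :: s. *)
Definition subdivision_sum (h : X -> X -> \bar R) a b g (s : seq R) : \bar R :=
  let t := nth b (a :: s) in
  \sum_(0 <= i < size s) h (g (t i)) (g (t i.+1)).

Definition tau_length a b g : \bar R :=
  ereal_inf [set subdivision_sum (tsep X) a b g s | s in itv_partition a b].

Definition d_length a b g : \bar R :=
  ereal_sup [set subdivision_sum (ldist X) a b g s | s in itv_partition a b].

Definition strongly_causal : Prop :=
  @open X = [set \bigcup_(B in F) B | F in
    [set F | F `<=` finI_from setT (fun p : X * X => diamond p.1 p.2)]].

Definition causally_path_connected : Prop :=
  (forall x y, chron X x y -> exists a b g, timelike_curve_between x y a b g) /\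
  (forall x y, caus X x y -> exists a b g, causal_curve_between x y a b g).

Definition causally_closed U : Prop :=
  forall (p_ q_ : nat -> X) p q,
    (forall n, U (p_ n)) -> (forall n, U (q_ n)) ->
    (forall n, caus X (p_ n) (q_ n)) ->
    p_ @ \oo --> p -> q_ @ \oo --> q -> closure U p -> closure U q ->
    caus X p q.

Definition locally_causally_closed : Prop :=
  forall x, exists2 U, nbhs x U & causally_closed U.

Definition intrinsic : Prop := forall x y,
  tsep X x y = esup0 [set l | exists a b g,
    causal_curve_between x y a b g /\ l = tau_length a b g].

(* (U, d, <<, <=, w) with d, << and <= restricted to U. *)
Definition restriction U (w : U -> U -> R) : lorentz_data R :=
  @LorentzData R U
    (fun p q : U => ldist X (\val p) (\val q))
    (fun p q : U => chron X (\val p) (\val q))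
    (fun p q : U => caus X (\val p) (\val q))
    (fun p q : U => (w p q)%:E).

Definition maximal_in U p q a b g : Prop :=
  [/\ causal_curve_between p q a b g, curve_in U a b g &
      forall a' b' g', causal_curve_between p q a' b' g' ->
        curve_in U a' b' g' -> tau_length a' b' g' <= tau_length a b g].

Definition localizable_set U : Prop :=
  (exists2 C : R, (0 < C)%R & forall a b g,
     causal_curve a b g -> curve_in U a b g -> d_length a b g <= C%:E) /\
  exists w : U -> U -> R,
    [/\ (forall p q : U, (0 <= w p q)%R),
        continuous (fun pq : U * U => w pq.1 pq.2),
        lorentzian_prelength (restriction w),
        (forall p, U p -> future p `&` U !=set0 /\ past p `&` U !=set0) &
        (forall p q : U, caus X (\val p) (\val q) ->
          exists a b g, maximal_in U (\val p) (\val q) a b g /\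
            tau_length a b g = (w p q)%:E)].

Definition localizable : Prop :=
  forall x, exists2 U, nbhs x U & localizable_set U.

Definition strongly_localizable : Prop :=
  forall x V, nbhs x V ->
    exists U, [/\ nbhs x U, U `<=` V & localizable_set U].

Record lorentzian_length_space : Prop := {
  lls_prelength : lorentzian_prelength X;
  lls_locally_causally_closed : locally_causally_closed;
  lls_causally_path_connected : causally_path_connected;
  lls_localizable : localizable;
  lls_intrinsic : intrinsic }.

Definition non_future_locally_isolating A : Prop :=
  forall a : X, A a -> future a !=set0 -> forall U, nbhs a U ->
    exists b : X, [/\ U b, A b & chron X a b].

Definition non_past_locally_isolating A : Prop :=
  forall a : X, A a -> past a !=set0 -> forall U, nbhs a U ->
    exists b : X, [/\ U b, A b & chron X b a].

Definition non_timelike_locally_isolating A : Prop :=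
  non_future_locally_isolating A /\ non_past_locally_isolating A.

End LorentzianNotions.

Definition homeomorphism (S T : topologicalType) (f : S -> T) : Prop :=
  continuous f /\
  exists g : T -> S, [/\ cancel f g, cancel g f & continuous g].

Section GluingHypotheses.
Context {R : realType} (X1 X2 : lorentz_data R) (A1 : set X1) (A2 : set X2).

(* The constant L is taken positive because 0 * +oo = 0 in [\bar R]. *)
Definition locally_bilipschitz (f : A1 -> A2) : Prop :=
  forall a : A1, exists2 U : set A1, nbhs a U &
    exists2 L : R, (0 < L)%R & forall x y : A1, U x -> U y ->
      ldist X2 (\val (f x)) (\val (f y)) <= L%:E * ldist X1 (\val x) (\val y) /\
      ldist X1 (\val x) (\val y) <= L%:E * ldist X2 (\val (f x)) (\val (f y)).

Record gluing (f : A1 -> A2) : Prop := {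
  gluing_closed1 : closed A1;
  gluing_closed2 : closed A2;
  gluing_isolating1 : non_timelike_locally_isolating A1;
  gluing_isolating2 : non_timelike_locally_isolating A2;
  gluing_homeo : homeomorphism f;
  gluing_bilipschitz : locally_bilipschitz f;
  gluing_future : forall a : A1,
    future (\val a) !=set0 <-> future (\val (f a)) !=set0;
  gluing_past : forall a : A1,
    past (\val a) !=set0 <-> past (\val (f a)) !=set0;
  gluing_tsep : forall a b : A1,
    tsep X1 (\val a) (\val b) = tsep X2 (\val (f a)) (\val (f b));
  gluing_caus : forall a b : A1,
    caus X1 (\val a) (\val b) <-> caus X2 (\val (f a)) (\val (f b)) }.

End GluingHypotheses.

Section DisjointUnion.
Context {R : realType} (X1 X2 : lorentz_data R).

Definition sum_dist (x y : X1 + X2) : \bar R :=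
  match x, y with
  | inl x, inl y => ldist X1 x y
  | inr x, inr y => ldist X2 x y
  | _, _ => +oo
  end.

Definition sum_tsep (x y : X1 + X2) : \bar R :=
  match x, y with
  | inl x, inl y => tsep X1 x y
  | inr x, inr y => tsep X2 x y
  | _, _ => 0
  end.

Definition sum_chron (x y : X1 + X2) : Prop :=
  match x, y with
  | inl x, inl y => chron X1 x y
  | inr x, inr y => chron X2 x y
  | _, _ => False
  end.

Definition sum_caus (x y : X1 + X2) : Prop :=
  match x, y with
  | inl x, inl y => caus X1 x y
  | inr x, inr y => caus X2 x y
  | _, _ => False
  end.

Definition disjoint_union : lorentz_data R :=
  LorentzData sum_dist sum_chron sum_caus sum_tsep.

End DisjointUnion.

(* c = [:: (x_1, y_1); ...; (x_n, y_n)] satisfies x E x_1, y_i E x_(i+1),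
   y_n E y and x_i r y_i; for n = 0 this would read x E y. *)
Fixpoint chain (S : Type) (E r : S -> S -> Prop) (x y : S) (c : seq (S * S)) :
    Prop :=
  match c with
  | [::] => E x y
  | p :: c' => [/\ E x p.1, r p.1 p.2 & chain E r p.2 y c']
  end.

Section Amalgamation.
Context {R : realType} (X1 X2 : lorentz_data R) (A1 : set X1) (A2 : set X2).
Variable f : A1 -> A2.

Definition glue_rel (x y : X1 + X2) : Prop :=
  exists a : A1, x = inl (\val a) /\ y = inr (\val (f a)).

Definition glue : X1 + X2 -> X1 + X2 -> Prop :=
  Relation_Operators.clos_refl_sym_trans (X1 + X2) glue_rel.

Definition glueb (x y : X1 + X2) : bool := `[< glue x y >].

Lemma glueb_refl : reflexive glueb.
Proof. by move=> x; apply/asboolP; exact: Relation_Operators.rst_refl. Qed.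

Lemma glueb_sym : symmetric glueb.
Proof.
by move=> x y; apply/asboolP/asboolP; exact: Relation_Operators.rst_sym.
Qed.

Lemma glueb_trans : transitive glueb.
Proof.
move=> y x z /asboolP xy /asboolP yz; apply/asboolP.
exact: Relation_Operators.rst_trans xy yz.
Qed.

Definition glue_equiv : equiv_rel (X1 + X2)%type :=
  EquivRel glueb glueb_refl glueb_sym glueb_trans.

Definition amalgam_car : Type := {eq_quot glue_equiv}.
Definition amalgam_class (x : X1 + X2) : amalgam_car :=
  \pi_({eq_quot glue_equiv}) x.

Lemma amalgam_classP x y : amalgam_class x = amalgam_class y <-> glue x y.
Proof.
split=> [/eqquotP/asboolP //|xy]; apply/eqquotP/asboolP; exact: xy.
Qed.

Definition causal_chains (x y : X1 + X2) : set (seq ((X1 + X2) * (X1 + X2))) :=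
  [set c | c <> [::] /\ chain glue (@sum_caus R X1 X2) x y c].

Definition chains (x y : X1 + X2) : set (seq ((X1 + X2) * (X1 + X2))) :=
  [set c | c <> [::] /\ chain glue (fun _ _ => True) x y c].

Definition glue_tsep (x y : X1 + X2) : \bar R :=
  esup0 [set \sum_(p <- c) sum_tsep p.1 p.2 | c in causal_chains x y].

Definition glue_dist (x y : X1 + X2) : \bar R :=
  ereal_inf [set \sum_(p <- c) sum_dist p.1 p.2 | c in chains x y].

Definition amalgam_repr (p : amalgam_car) : X1 + X2 :=
  repr (p : {eq_quot glue_equiv}).

(* The formulas do not depend on the representatives chosen: see
   [amalgam_tsepE], [amalgam_causE], [amalgam_distE]. *)
Definition amalgam : lorentz_data R :=
  @LorentzData R amalgam_car
    (fun p q => glue_dist (amalgam_repr p) (amalgam_repr q))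
    (fun p q => 0 < glue_tsep (amalgam_repr p) (amalgam_repr q))
    (fun p q => causal_chains (amalgam_repr p) (amalgam_repr q) !=set0)
    (fun p q => glue_tsep (amalgam_repr p) (amalgam_repr q)).

Lemma glue_repr x : glue (amalgam_repr (amalgam_class x)) x.
Proof. by apply/amalgam_classP; rewrite /amalgam_class reprK. Qed.

Lemma chain_glue r x x' y y' c : glue x x' -> glue y y' ->
  chain glue r x y c -> chain glue r x' y' c.
Proof.
have gt := @Relation_Operators.rst_trans _ glue_rel.
have gs := @Relation_Operators.rst_sym _ glue_rel.
elim: c x x' => [|p c ih] x x' xx' yy' /=.
  by move=> xy; exact: gt _ _ _ (gs _ _ xx') (gt _ _ _ xy yy').
case=> xp rp pc; split => //; first exact: gt _ _ _ (gs _ _ xx') xp.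
by apply: ih pc => //; exact: Relation_Operators.rst_refl.
Qed.

Lemma chains_repr r x y :
  [set c | c <> [::] /\
     chain glue r (amalgam_repr (amalgam_class x))
       (amalgam_repr (amalgam_class y)) c] =
  [set c | c <> [::] /\ chain glue r x y c].
Proof.
have gs := @Relation_Operators.rst_sym _ glue_rel.
apply/seteqP; split=> c /= [c0 cc]; split => //; apply: chain_glue cc.
- exact: glue_repr.
- exact: glue_repr.
- exact/gs/glue_repr.
- exact/gs/glue_repr.
Qed.

Lemma amalgam_tsepE x y :
  tsep amalgam (amalgam_class x) (amalgam_class y) = glue_tsep x y.
Proof. by rewrite /= /glue_tsep /causal_chains chains_repr. Qed.

Lemma amalgam_distE x y :
  ldist amalgam (amalgam_class x) (amalgam_class y) = glue_dist x y.
Proof. by rewrite /= /glue_dist /chains chains_repr. Qed.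

Lemma amalgam_causE x y :
  caus amalgam (amalgam_class x) (amalgam_class y) =
  (causal_chains x y !=set0).
Proof. by rewrite /= /causal_chains chains_repr. Qed.

End Amalgamation.

(* Main.v *)
Require Import Defs.
From mathcomp Require Import all_boot all_order all_algebra.
From mathcomp Require Import all_classical all_reals all_analysis.
From mathcomp Require Import finmap lra.
Import Order.TTheory GRing.Theory Num.Theory.
Import numFieldNormedType.Exports.

Set Implicit Arguments.
Unset Strict Implicit.
Unset Printing Implicit Defensive.

Local Open Scope classical_set_scope.
Local Open Scope ring_scope.
Local Open Scope ereal_scope.

(** Why the amalgam is again a length space.

    Both spaces embed in the amalgam, and since the glueing map preserves the
    causal relation and the time separation, a chain that leaves a side and
    comes back to it can be shortened to a single relation on that side
    ([chain_crossing]).  Hence the amalgam induces on each side the relations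
    and the time separation of that side, and two points of different sides are
    related exactly when one crossing of the seam relates them, their time
    separation being the supremum of [tau(x, a) + tau(a, y)] over the crossing
    points [a].  The topology is as simple: the glueing map being locally
    bi-Lipschitz, the glued distance induces the quotient topology, and both
    sides are closed subspaces ([amalgam_ball], [amalgam_trace]).  The record
    [glued] collects these facts in a form symmetric in the two sides, and
    [glued_length_space] derives the theorem from them alone.

    Lower semicontinuity of the time separation and timelike connectedness rest
    on [timelike_crossing]: because the seam is nowhere timelike isolated, the
    crossing point of a broken path of positive length can be pushed along the
    seam until both pieces are timelike.

    All local properties are proved on causally convex neighbourhoods [V].
    Diamonds with vertices on one side restrict on that side to the diamonds of
    that side, so strong causality of the sides yields arbitrarily small such
    [V], with traces contained in sets that are localizable, causally closed
    and relatively compact ([small_convex_nbhs]).  By convexity the crossing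
    points of relations between points of [V] stay in [V], hence in a compact
    set, so they converge along subsequences and the limits are crossing points
    again ([crossing_limit], [crossing_usc]).  This gives three facts: causal
    closedness; upper semicontinuity, hence continuity and finiteness, of the
    time separation on [V]; and the existence of an optimal crossing point,
    through which two maximal curves of the sides concatenate to a maximal
    curve.

    A causal curve of the amalgam may oscillate between the sides, so that the
    length bounds of the sides do not apply to it directly.  On each side the
    bound is turned into a potential that drops along a causal relation by at
    least the distance ([length_potential_drop]).  The sum of the two potentials
    has the same property on [V] ([potential_drop]), and telescoping bounds the
    length of every causal curve in [V] ([glued_d_length]). *)

(** * Extended reals, sequences and metric topologies *)

Section ExtendedReals.
Context {R : realType}.
Implicit Types (S : set (\bar R)) (u v w : \bar R) (c : R).

Lemma esup0_ge0 S : 0 <= esup0 S.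
Proof. by apply: ereal_sup_ubound; left. Qed.

Lemma esup0_ub S u : S u -> u <= esup0 S.
Proof. by move=> Su; apply: ereal_sup_ubound; right. Qed.

Lemma esup0_le S u : 0 <= u -> (forall v, S v -> v <= u) -> esup0 S <= u.
Proof. by move=> u0 Su; apply: ge_ereal_sup => v [->//|/Su]. Qed.

Lemma esup0_gt S u : 0 <= u -> u < esup0 S -> exists2 v, S v & u < v.
Proof.
move=> u0 /ereal_sup_gt[v [->|Sv] uv]; last by exists v.
by move: uv; rewrite ltNge u0.
Qed.

Lemma lte_add_split c u v : c%:E < u + v -> 0 < u -> 0 < v ->
  exists u' v' : R, [/\ u'%:E < u, v'%:E < v, (0 <= u')%R, (0 <= v')%R &
    (c <= u' + v')%R].
Proof.
have maxc : (0 <= Num.max c 0%R)%R by rewrite le_max lexx orbT.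
case: u => [r| |] //; case: v => [s| |] //; rewrite ?lte_fin => h r0 s0.
- have {}h : (c < r + s)%R by rewrite -lte_fin.
  case: (leP c 0%R) => c0.
    by exists (0%R : R), (0%R : R); rewrite !lte_fin; split => //; lra.
  exists (r * (c / (r + s)))%R, (s * (c / (r + s)))%R.
  have rs0 : (0 < r + s)%R by lra.
  have c1 : (c / (r + s) < 1)%R by rewrite ltr_pdivrMr ?mul1r.
  have c2 : (0 <= c / (r + s))%R by rewrite divr_ge0 // ltW.
  rewrite !lte_fin; split.
  + by rewrite gtr_pMr.
  + by rewrite gtr_pMr.
  + by rewrite mulr_ge0 // ltW.
  + by rewrite mulr_ge0 // ltW.
  + by rewrite -mulrDl mulrCA divff ?mulr1 // gt_eqF.
- exists (0%R : R), (Num.max c 0%R)%R; split; rewrite ?ltry ?lte_fin //.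
  by rewrite add0r le_max lexx.
- exists (Num.max c 0%R)%R, (0%R : R); split; rewrite ?ltry ?lte_fin //.
  by rewrite addr0 le_max lexx.
- exists (Num.max c 0%R)%R, (0%R : R); split; rewrite ?ltry ?lte_fin //.
  by rewrite addr0 le_max lexx.
Qed.

Lemma gte_add_split c u v : u \is a fin_num -> v \is a fin_num ->
  u + v < c%:E ->
  exists u' v' : R, [/\ u < u'%:E, v < v'%:E & (u' + v' <= c)%R].
Proof.
case: u => [r| |] // _; case: v => [s| |] // _; rewrite -EFinD lte_fin => h.
by exists (r + (c - (r + s)) / 2)%R, (s + (c - (r + s)) / 2)%R;
  rewrite !lte_fin; split; lra.
Qed.

Lemma esup0_addl S u v : 0 <= u -> S !=set0 -> (forall s, S s -> 0 <= s) ->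
  (forall s, S s -> u + s <= v) -> u + esup0 S <= v.
Proof.
move=> u0 [s0 Ss0] S0 uS.
have v0 : u <= v by apply: le_trans (uS _ Ss0); rewrite leeDl ?S0.
case: u u0 uS v0 => [u| |] // u0 uS v0.
  rewrite addeC -leeBrDr //; apply: esup0_le => [|s Ss].
    by rewrite leeBrDr // add0e.
  by rewrite leeBrDr // addeC uS.
by move: v0; rewrite leye_eq => /eqP ->; rewrite leey.
Qed.

Lemma esup0_sup_add S T u : S !=set0 -> T !=set0 ->
  (forall s, S s -> 0 <= s) -> (forall t, T t -> 0 <= t) ->
  (forall s t, S s -> T t -> s + t <= u) -> esup0 S + esup0 T <= u.
Proof.
move=> S1 T1 S0 T0 ST; apply: esup0_addl => //; first exact: esup0_ge0.
move=> t Tt; rewrite addeC; apply: esup0_addl => //; first exact: T0.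
by move=> s Ss; rewrite addeC ST.
Qed.

Lemma le_inf_add S T u :
  (forall s, S s -> 0 <= s) -> (forall t, T t -> 0 <= t) ->
  (forall s t, S s -> T t -> u <= s + t) -> u <= ereal_inf S + ereal_inf T.
Proof.
move=> S0 T0 ST; rewrite leNgt; apply/negP => h.
have inf0 (A : set (\bar R)) : (forall s, A s -> 0 <= s) -> 0 <= ereal_inf A.
  by move=> A0; exact: le_ereal_inf_tmp.
have fin (v w : \bar R) : 0 <= v -> 0 <= w -> v + w < u -> v \is a fin_num.
  case: v => [v| |] // _ w0; rewrite addye ?gt_eqF ?(lt_le_trans _ w0) //.
  by rewrite ltNge leey.
have fS := fin _ _ (inf0 _ S0) (inf0 _ T0) h.
have fT : ereal_inf T \is a fin_num.
  by apply: (fin _ (ereal_inf S)); rewrite ?inf0 // addeC.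
have [c hc cu] : exists2 c : R, ereal_inf S + ereal_inf T < c%:E & c%:E <= u.
  have fST : ereal_inf S + ereal_inf T \is a fin_num by rewrite fin_numD fS.
  case: (u) h => [r| |] h; first by exists r.
    exists (fine (ereal_inf S + ereal_inf T) + 1)%R; rewrite ?leey //.
    by rewrite EFinD fineK // lteDl.
  by move: h; rewrite ltNge leNye.
have [a [b [Sa Tb ab]]] := gte_add_split fS fT hc.
have [s Ss sa] := ereal_inf_lt Sa; have [t Tt tb] := ereal_inf_lt Tb.
have := lt_le_trans (lteD sa tb) (le_trans (_ : (a + b)%R%:E <= c%:E) cu).
by rewrite lee_fin ltNge ST // => /(_ ab).
Qed.

End ExtendedReals.

Section Sequences.

Lemma cvg_subseq (T : topologicalType) (u : nat -> T) (l : T)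
  (phi : nat -> nat) : (forall n, (n <= phi n)%N) ->
  u @ \oo --> l -> (u \o phi) @ \oo --> l.
Proof.
move=> phin ul; apply: cvg_comp ul => A [N _ NA].
by exists N => // n /= Nn; apply: NA => /=; exact: leq_trans Nn (phin n).
Qed.

Lemma bool_subseq (t : nat -> bool) : exists b, exists2 phi : nat -> nat,
  (forall n, (n <= phi n)%N) & forall n, t (phi n) = b.
Proof.
have [h|/existsNP[N hN]] := pselect (forall N, exists2 n, (N <= n)%N & t n).
  have /choice[phi phiP] : forall N, exists n, (N <= n)%N /\ t n.
    by move=> N; have [n] := h N; exists n.
  by exists true, phi => n; have [] := phiP n.
exists false, (addn N) => n; first exact: leq_addl.
by apply/negbTE/negP => tn; apply: hN; exists (N + n)%N; rewrite ?leq_addr.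
Qed.

Lemma small_inv (R : realType) (e : R) : (0 < e)%R ->
  exists N, forall n, (N <= n)%N -> (n.+1%:R^-1 < e)%R.
Proof.
move=> e0; exists (Num.truncn e^-1) => n Nn.
rewrite invf_plt ?posrE //.
by rewrite (lt_le_trans (truncnS_gt _)) // ler_nat ltnS.
Qed.

Lemma approx_below (R : realType) (M : \bar R) : 0 < M ->
  exists c : nat -> \bar R,
  (forall n, 0 <= c n < M) /\
  (forall r : R, r%:E < M -> \forall n \near \oo, r%:E < c n).
Proof.
case: M => [m| |] // m0.
  rewrite lte_fin in m0.
  exists (fun n => (Num.max 0 (m - n.+1%:R^-1))%R%:E); split=> [n|r].
    rewrite lee_fin lte_fin le_max lexx /= gt_max m0 /=.
    by rewrite gtrBl invr_gt0.
  rewrite lte_fin => rm; have mr : (0 < m - r)%R by rewrite subr_gt0.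
  have [N h] := small_inv mr; exists N => // n /= /h nr.
  by rewrite lte_fin lt_max ltrBrDl -ltrBrDr nr orbT.
exists (fun n => n%:R%:E); split=> [n|r _].
  by rewrite lee_fin ltry ler0n.
exists (Num.truncn r).+1 => // n /= rn; rewrite lte_fin.
by rewrite (lt_le_trans (truncnS_gt _)) // ler_nat.
Qed.

End Sequences.

Lemma nbhs_metricP (R : realType) (X : lorentz_data R) :
  (forall x y : X, 0 <= ldist X x y) -> (forall x : X, ldist X x x = 0) ->
  (forall x y z : X, ldist X x z <= ldist X x y + ldist X y z) ->
  forall (x : X) (S : set X), nbhs x S <->
    exists2 e : R, (0 < e)%R & forall y, ldist X x y < e%:E -> S y.
Proof.
move=> d_ge0 dxx d_triangle x S.
split=> [|[e e0 eS]].
  rewrite nbhsE => -[B [oB Bx] BS].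
  by have [e e0 eB] := oB _ Bx; exists e => // y /eB/BS.
rewrite nbhsE; exists [set y | ldist X x y < e%:E] => //; split; last first.
  by rewrite /= dxx lte_fin.
move=> y /= xy.
have xyf : ldist X x y \is a fin_num.
  by rewrite ge0_fin_numE ?d_ge0 // (lt_trans xy) ?ltry.
exists (e - fine (ldist X x y))%R.
  by rewrite subr_gt0 -lte_fin fineK.
move=> z yz; apply: le_lt_trans (d_triangle _ y _) _.
by rewrite -(fineK xyf) addeC -lteBrDr // EFinB.
Qed.

Section PreLength.
Context {R : realType} (X : lorentz_data R) (PX : lorentzian_prelength X).
Implicit Types (x y z : X) (U V S : set X).

Lemma ldistxx x : ldist X x x = 0.
Proof. by apply/(ldist_eq0 PX). Qed.

Lemma nbhs_ldistP x S : nbhs x S <->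
  exists2 e : R, (0 < e)%R & forall y, ldist X x y < e%:E -> S y.
Proof.
exact: (nbhs_metricP (ldist_ge0 PX) ldistxx (ldist_triangle PX)).
Qed.

Lemma nbhs_ball x (e : R) : (0 < e)%R -> nbhs x [set y | ldist X x y < e%:E].
Proof. by move=> e0; apply/nbhs_ldistP; exists e. Qed.

Lemma cvg_radius (u : nat -> X) x :
  (forall n, ldist X x (u n) < ((n.+1%:R^-1)%R)%:E) -> u @ \oo --> x.
Proof.
move=> ux S /nbhs_ldistP[e e0 eS].
have [N NP] := small_inv e0.
exists N => // n /= Nn; apply: eS; apply: lt_trans (ux n) _.
by rewrite lte_fin NP.
Qed.

(** Compactness gives subsequences because balls of radius 1/(n+1) around a
    cluster point form a countable neighbourhood basis. *)
Lemma compact_subseq U (u : nat -> X) : compact U -> (forall n, U (u n)) ->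
  exists2 x, U x & exists2 phi : nat -> nat, (forall n, (n <= phi n)%N) &
    (u \o phi) @ \oo --> x.
Proof.
move=> cU Uu.
have [|x [Ux clx]] := cU (u @ \oo) _.
  by exists 0%N => // n _ /=; exact: Uu.
exists x => //.
have /choice[phi phiP] : forall n, exists m,
    (n <= m)%N /\ ldist X x (u m) < ((n.+1%:R^-1)%R)%:E.
  move=> n.
  have r0 : (0 < n.+1%:R^-1 :> R)%R by rewrite invr_gt0.
  have [|y [[m /= nm <-] xm]] :=
    clx [set y | exists2 m, (n <= m)%N & u m = y] _ _ (nbhs_ball x r0).
    by exists n => // m nm; exists m.
  by exists m.
exists phi => [n|]; first by have [] := phiP n.
by apply: cvg_radius => n; have [] := phiP n.
Qed.

End PreLength.

(** * Time separation and causal convexity *)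

Lemma not_near_seq (R : realType) (X Y : lorentz_data R)
    (PX : lorentzian_prelength X) (PY : lorentzian_prelength Y)
    (x : X) (y : Y) (P : X * Y -> Prop) :
  ~ (\forall z \near (x, y), P z) ->
  exists (u : nat -> X) (v : nat -> Y),
    [/\ u @ \oo --> x, v @ \oo --> y & forall n, ~ P (u n, v n)].
Proof.
move=> nP.
have /choice[w wP] : forall n, exists z : X * Y,
    [/\ ldist X x z.1 < ((n.+1%:R^-1)%R)%:E,
        ldist Y y z.2 < ((n.+1%:R^-1)%R)%:E & ~ P z].
  move=> n; apply: contrapT => h; apply: nP.
  have n0 : (0 < n.+1%:R^-1 :> R)%R by rewrite invr_gt0.
  exists ([set x' | ldist X x x' < ((n.+1%:R^-1)%R)%:E],
          [set y' | ldist Y y y' < ((n.+1%:R^-1)%R)%:E]).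
    by split; exact: nbhs_ball.
  by move=> z [xz yz]; apply: contrapT => nPz; apply: h; exists z.
exists (fun n => (w n).1), (fun n => (w n).2); split=> [||n].
- by apply: cvg_radius => // n; have [] := wP n.
- by apply: cvg_radius => // n; have [] := wP n.
- by have [_ _] := wP n; case: (w n).
Qed.

Section Chronology.
Context {R : realType} (X : lorentz_data R) (PX : lorentzian_prelength X).
Implicit Types (x y z : X) (U V S : set X).

Lemma caus_chron x y z : caus X x y -> chron X y z -> chron X x z.
Proof.
move=> xy yz; apply/(tsep_gt0 PX).
apply: lt_le_trans (tsep_reverse_triangle PX xy (chron_caus PX yz)).
rewrite (lt_le_trans (_ : 0 < tsep X y z)) ?leeDr ?(tsep_ge0 PX) //.
exact/(tsep_gt0 PX).
Qed.

Lemma chron_caus_trans x y z : chron X x y -> caus X y z -> chron X x z.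
Proof.
move=> xy yz; apply/(tsep_gt0 PX).
apply: lt_le_trans (tsep_reverse_triangle PX (chron_caus PX xy) yz).
rewrite (lt_le_trans (_ : 0 < tsep X x y)) ?leeDl ?(tsep_ge0 PX) //.
exact/(tsep_gt0 PX).
Qed.

Lemma tsep_not_caus x y : ~ caus X x y -> tsep X x y = 0.
Proof.
move=> nxy; apply/eqP; rewrite eq_le (tsep_ge0 PX) andbT leNgt.
by apply/negP => /(tsep_gt0 PX)/(chron_caus PX).
Qed.

Lemma tsep_near x y (c : R) : c%:E < tsep X x y ->
  \forall x' \near x & y' \near y, c%:E < tsep X x' y'.
Proof. by move=> /(tsep_lsc PX (x := (x, y)))[V nV VP]; apply: filterS nV. Qed.

Lemma tsep_near_l x y (c : R) : c%:E < tsep X x y ->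
  \forall x' \near x, c%:E < tsep X x' y.
Proof.
move=> /tsep_near[[A B] /= [nA nB] AB].
by apply: filterS nA => x' Ax'; apply: (AB (x', y)); split => //=;
  exact: nbhs_singleton.
Qed.

Lemma tsep_near_r x y (c : R) : c%:E < tsep X x y ->
  \forall y' \near y, c%:E < tsep X x y'.
Proof.
move=> /tsep_near[[A B] /= [nA nB] AB].
by apply: filterS nB => y' Ay'; apply: (AB (x, y')); split => //=;
  exact: nbhs_singleton.
Qed.

Lemma open_future x : open (future x).
Proof.
rewrite openE => y /(tsep_gt0 PX)/tsep_near_r; apply: filterS => z.
by move=> h; apply/(tsep_gt0 PX).
Qed.

Lemma open_past x : open (past x).
Proof.
rewrite openE => y /(tsep_gt0 PX)/tsep_near_l; apply: filterS => z.
by move=> h; apply/(tsep_gt0 PX).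
Qed.

Lemma open_diamond x y : open (diamond x y).
Proof. by apply: openI; [exact: open_future|exact: open_past]. Qed.

Definition causally_convex V := forall x y z,
  V x -> V z -> caus X x y -> caus X y z -> V y.

Lemma causally_convex_diamond x y : causally_convex (diamond x y).
Proof.
move=> u v w [xu uy] [xw wy] uv vw; split.
  exact: chron_caus_trans uv.
exact: caus_chron wy.
Qed.

Lemma causally_convexI U V :
  causally_convex U -> causally_convex V -> causally_convex (U `&` V).
Proof.
by move=> cU cV x y z [Ux Vx] [Uz Vz] xy yz; split;
  [exact: cU xy yz|exact: cV xy yz].
Qed.

Lemma causal_curve_in V a b (g : R -> X) : causally_convex V ->
  V (g a) -> V (g b) -> causal_curve a b g -> curve_in V a b g.
Proof.
move=> cV Va Vb [ab _ mg] t; rewrite in_itv /= => /andP[at_ tb].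
have aI : a \in `[a, b] by rewrite in_itv /= lexx ltW.
have bI : b \in `[a, b] by rewrite in_itv /= lexx ltW.
have tI : t \in `[a, b] by rewrite in_itv /= at_ tb.
apply: (cV (g a) _ (g b)) => //.
  by move: at_; rewrite le_eqVlt => /predU1P[<-|/mg]; [exact: caus_refl|exact].
by move: tb; rewrite le_eqVlt => /predU1P[->|/mg]; [exact: caus_refl|exact].
Qed.

End Chronology.

(** * Curves and their lengths *)

Section Subdivisions.
Context {R : realType}.
Implicit Types (a b c t : R) (s : seq R).

Lemma itv_partition_cons_itv a b x s : itv_partition a b (x :: s) ->
  [/\ (a < x)%R, (x <= b)%R & itv_partition x b s].
Proof.
move=> h; have xs := itv_partition_cons h; split=> //.
  by case: h => /= /andP[].
exact: itv_partition_le xs.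
Qed.

Lemma subdivision_sum_nil (X : lorentz_data R) (h : X -> X -> \bar R) a b g :
  subdivision_sum h a b g [::] = 0.
Proof. by rewrite /subdivision_sum big_geq. Qed.

Lemma subdivision_sum_cons (X : lorentz_data R) (h : X -> X -> \bar R) a b g
    x s :
  subdivision_sum h a b g (x :: s) =
  h (g a) (g x) + subdivision_sum h x b g s.
Proof. by rewrite /subdivision_sum /= big_nat_recl. Qed.

Lemma eq_subdivision_sum (X Y : lorentz_data R) (h : X -> X -> \bar R)
    (k : Y -> Y -> \bar R) a b g g' s :
  (forall t t', t \in `[a, b] -> t' \in `[a, b] ->
    h (g t) (g t') = k (g' t) (g' t')) ->
  itv_partition a b s ->
  subdivision_sum h a b g s = subdivision_sum k a b g' s.
Proof.
elim: s a => [|x s ih] a gg'; first by rewrite !subdivision_sum_nil.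
move=> /itv_partition_cons_itv[ax xb xs]; rewrite !subdivision_sum_cons.
congr (_ + _).
  by apply: gg'; rewrite in_itv /= ?lexx ?(ltW ax) ?xb // (le_trans (ltW ax)).
apply: ih => // t t'; rewrite !in_itv /= => /andP[xt tb] /andP[xt' tb'].
by apply: gg'; rewrite in_itv /= ?tb ?tb' andbT (le_trans (ltW ax)).
Qed.

Lemma eq_tau_length (X Y : lorentz_data R) a b (g : R -> X) (g' : R -> Y) :
  (forall t t', t \in `[a, b] -> t' \in `[a, b] ->
    tsep X (g t) (g t') = tsep Y (g' t) (g' t')) ->
  tau_length a b g = tau_length a b g'.
Proof.
move=> gg'; congr (ereal_inf _); apply/seteqP; split=> _ [s abs <-];
  by exists s => //; last rewrite (eq_subdivision_sum gg').
Qed.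

Lemma eq_d_length (X Y : lorentz_data R) a b (g : R -> X) (g' : R -> Y) :
  (forall t t', t \in `[a, b] -> t' \in `[a, b] ->
    ldist X (g t) (g t') = ldist Y (g' t) (g' t')) ->
  d_length a b g = d_length a b g'.
Proof.
move=> gg'; congr (ereal_sup _); apply/seteqP; split=> _ [s abs <-];
  by exists s => //; last rewrite (eq_subdivision_sum gg').
Qed.

Lemma itv_partition_shift a b c s : itv_partition a b s ->
  itv_partition (a + c)%R (b + c)%R [seq (t + c)%R | t <- s].
Proof.
elim: s a => [|x s ih] a.
  by move=> /itv_partition_nil ->; split => /=.
move=> /itv_partition_cons_itv[ax xb /ih[h1 h2]]; split => //=.
by rewrite ltrD2r ax.
Qed.

Lemma subdivision_sum_shift (X : lorentz_data R) (h : X -> X -> \bar R) a b c g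
    s :
  subdivision_sum h (a + c)%R (b + c)%R (fun t => g (t - c)%R)
    [seq (t + c)%R | t <- s] = subdivision_sum h a b g s.
Proof.
elim: s a => [|x s ih] a; first by rewrite !subdivision_sum_nil.
by rewrite /= !subdivision_sum_cons ih !addrK.
Qed.

Lemma tau_length_shift (X : lorentz_data R) a b c (g : R -> X) :
  tau_length (a + c)%R (b + c)%R (fun t => g (t - c)%R) = tau_length a b g.
Proof.
congr (ereal_inf _); apply/seteqP; split=> _ [s abs <-]; last first.
  exists [seq (t + c)%R | t <- s]; first exact: itv_partition_shift.
  exact: subdivision_sum_shift.
exists [seq (t - c)%R | t <- s].
  by have := itv_partition_shift (- c)%R abs; rewrite !addrK.
rewrite -(subdivision_sum_shift _ _ _ c) -map_comp map_id_in // => t _ /=.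
by rewrite subrK.
Qed.

Lemma d_length_shift (X : lorentz_data R) a b c (g : R -> X) :
  d_length (a + c)%R (b + c)%R (fun t => g (t - c)%R) = d_length a b g.
Proof.
congr (ereal_sup _); apply/seteqP; split=> _ [s abs <-]; last first.
  exists [seq (t + c)%R | t <- s]; first exact: itv_partition_shift.
  exact: subdivision_sum_shift.
exists [seq (t - c)%R | t <- s].
  by have := itv_partition_shift (- c)%R abs; rewrite !addrK.
rewrite -(subdivision_sum_shift _ _ _ c) -map_comp map_id_in // => t _ /=.
by rewrite subrK.
Qed.

End Subdivisions.

Section Curves.
Context {R : realType} (X : lorentz_data R) (PX : lorentzian_prelength X).
Implicit Types (x y z : X) (U V S : set X) (r : X -> X -> Prop) (g : R -> X).
Implicit Types (a b c m t : R).

(** Causal and timelike curves are the instances [caus X] and [chron X]. *)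
Definition rel_curve r a b g : Prop :=
  [/\ (a < b)%R, locally_lipschitz_curve a b g & curve_monotone r a b g].

Lemma curve_near a b g t S : locally_lipschitz_curve a b g ->
  t \in `[a, b] -> nbhs (g t) S ->
  exists2 e : R, (0 < e)%R & forall s, s \in `[a, b] -> (`|s - t| < e)%R ->
    S (g s).
Proof.
move=> gl tab /(nbhs_ldistP PX)[r r0 rS].
have [e e0 [L gL]] := gl _ tab.
have L0 : (0 < `|L| + 1)%R by rewrite ltr_wpDl.
exists (Num.min e (r / (`|L| + 1)))%R; first by rewrite lt_min e0 divr_gt0.
move=> s sab; rewrite lt_min => /andP[se sr]; apply: rS.
apply: le_lt_trans (gL _ _ tab sab _ se) _; first by rewrite subrr normr0.
rewrite lte_fin; move: sr; rewrite ltr_pdivlMr // distrC => sr.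
apply: le_lt_trans sr; rewrite mulrC ler_wpM2l //.
by rewrite (le_trans (ler_norm L)) // lerDl.
Qed.

Lemma rel_curve_shift r a b c g : rel_curve r a b g ->
  rel_curve r (a + c)%R (b + c)%R (fun t => g (t - c)%R).
Proof.
have sh t : (t \in `[(a + c)%R, (b + c)%R]) = ((t - c)%R \in `[a, b]).
  by rewrite !in_itv /= lerBrDr lerBlDr.
move=> [ab gl mg]; split; first by rewrite ltrD2r.
  move=> t; rewrite sh => /gl[e e0 [L gL]]; exists e => //; exists L.
  move=> s s'; rewrite !sh => sab sab' se se'.
  have E u v : (u - v = (u - c) - (v - c))%R by lra.
  by rewrite (E s s') gL // -?E.
by move=> s t; rewrite !sh => sab tab st; apply: mg => //; rewrite ltrD2r.
Qed.

Lemma rel_curve_translate r a b m g : rel_curve r a b g ->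
  exists b' g', [/\ rel_curve r m b' g', g' m = g a, g' b' = g b,
    tau_length m b' g' = tau_length a b g &
    d_length m b' g' = d_length a b g].
Proof.
move=> rg; exists (b + (m - a))%R, (fun t => g (t - (m - a))%R).
have am : (a + (m - a))%R = m by lra.
have h : (m - (m - a))%R = a by lra.
rewrite -[X in rel_curve r X]am -[X in tau_length X]am -[X in d_length X]am.
rewrite h // addrK; split => //.
- exact: rel_curve_shift.
- exact: tau_length_shift.
- exact: d_length_shift.
Qed.

Definition curve_concat m g g' t : X := if (t <= m)%R then g t else g' t.

Lemma curve_concatl m g g' t : (t <= m)%R -> curve_concat m g g' t = g t.
Proof. by rewrite /curve_concat => ->. Qed.

Lemma curve_concatr m g g' t : g m = g' m -> (m <= t)%R ->
  curve_concat m g g' t = g' t.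
Proof.
rewrite /curve_concat => gm; rewrite le_eqVlt => /predU1P[<-|mt].
  by rewrite lexx.
by rewrite leNgt mt.
Qed.

Lemma rel_curve_concat r a m b g g' :
  (forall x y z, r x y -> r y z -> r x z) ->
  rel_curve r a m g -> rel_curve r m b g' -> g m = g' m ->
  rel_curve r a b (curve_concat m g g').
Proof.
move=> rT [am gl mg] [mb gl' mg'] gm.
set k := curve_concat m g g'.
have ki s : s \in `[a, b] -> (s <= m)%R -> s \in `[a, m] /\ k s = g s.
  move=> + sm; rewrite !in_itv /= sm => /andP[-> _]; split => //.
  exact: curve_concatl.
have ki' s : s \in `[a, b] -> (m <= s)%R -> s \in `[m, b] /\ k s = g' s.
  move=> + ms; rewrite !in_itv /= ms => /andP[_ ->]; split => //.
  exact: curve_concatr.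
have mI : m \in `[a, m] by rewrite in_itv /= lexx ltW.
have mI' : m \in `[m, b] by rewrite in_itv /= lexx ltW.
split; first exact: lt_trans mb.
- move=> t tab; have [tm|tm|tm] := ltgtP t m.
  + have [e e0 [L gL]] := gl t (proj1 (ki _ tab (ltW tm))).
    exists (Num.min e (m - t))%R; first by rewrite lt_min e0 subr_gt0.
    exists L => s s' sab sab'; rewrite !lt_min => /andP[se st] /andP[se' st'].
    have sm : (s <= m)%R by have := ler_norm (s - t); lra.
    have sm' : (s' <= m)%R by have := ler_norm (s' - t); lra.
    have [? ->] := ki _ sab sm; have [? ->] := ki _ sab' sm'.
    exact: gL.
  + have [e e0 [L gL]] := gl' t (proj1 (ki' _ tab (ltW tm))).
    exists (Num.min e (t - m))%R; first by rewrite lt_min e0 subr_gt0.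
    exists L => s s' sab sab'; rewrite !lt_min => /andP[se st] /andP[se' st'].
    have sm : (m <= s)%R.
      by have := ler_norm (t - s); rewrite (distrC t); lra.
    have sm' : (m <= s')%R.
      by have := ler_norm (t - s'); rewrite (distrC t); lra.
    have [? ->] := ki' _ sab sm; have [? ->] := ki' _ sab' sm'.
    exact: gL.
  + rewrite {}tm in tab *.
    have [e e0 [L gL]] := gl m mI; have [e' e'0 [L' gL']] := gl' m mI'.
    exists (Num.min e e'); first by rewrite lt_min e0.
    exists (`|L| + `|L'|)%R.
    have LL (u : R) : (0 <= u)%R ->
        ((L * u)%:E <= ((`|L| + `|L'|) * u)%:E) /\
        ((L' * u)%:E <= ((`|L| + `|L'|) * u)%:E).
      move=> u0; rewrite !lee_fin; split; apply: ler_wpM2r => //.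
        by rewrite (le_trans (ler_norm L)) // lerDl.
      by rewrite (le_trans (ler_norm L')) // lerDr.
    have cross s s' : s \in `[a, b] -> s' \in `[a, b] -> (s <= m)%R ->
        (m <= s')%R -> (`|s - m| < e)%R -> (`|s' - m| < e')%R ->
        ldist X (k s) (k s') <= ((`|L| + `|L'|) * `|s - s'|)%:E.
      move=> sab sab' sm ms' se se'.
      have [? ->] := ki _ sab sm; have [? ->] := ki' _ sab' ms'.
      apply: le_trans (ldist_triangle PX _ (g m) _) _.
      have -> : (`|s - s'| = `|s - m| + `|m - s'|)%R.
        by rewrite !ler0_norm ?subr_le0 ?(le_trans sm) //; lra.
      rewrite mulrDr EFinD leeD //.
        apply: le_trans (gL _ _ _ mI se _) _ => //.
          by rewrite subrr normr0.
        by have [] := LL _ (normr_ge0 (s - m)%R).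
      rewrite gm; apply: le_trans (gL' _ _ mI' _ _ se') _ => //.
        by rewrite subrr normr0.
      by have [] := LL _ (normr_ge0 (m - s')%R).
    move=> s s' sab sab'; rewrite !lt_min => /andP[se se2] /andP[s'e s'e2].
    have [sm|/ltW sm] := leP s m; have [sm'|/ltW sm'] := leP s' m.
    * have [? ->] := ki _ sab sm; have [? ->] := ki _ sab' sm'.
      apply: le_trans (gL _ _ _ _ se s'e) _ => //.
      by have [] := LL _ (normr_ge0 (s - s')%R).
    * exact: cross.
    * by rewrite (ldist_sym PX) distrC; exact: cross.
    * have [? ->] := ki' _ sab sm; have [? ->] := ki' _ sab' sm'.
      apply: le_trans (gL' _ _ _ _ se2 s'e2) _ => //.
      by have [] := LL _ (normr_ge0 (s - s')%R).
- move=> s t sab tab st.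
  have [sm|/ltW sm] := leP s m; have [tm|/ltW tm] := leP t m.
  + have [? ->] := ki _ sab sm; have [? ->] := ki _ tab tm; exact: mg.
  + have [sI ->] := ki _ sab sm; have [tI ->] := ki' _ tab tm.
    move: sm tm; rewrite le_eqVlt => /predU1P[sE|sm].
      by move: st; rewrite sE gm => mt _; exact: mg'.
    rewrite le_eqVlt => /predU1P[<-|mt]; first by rewrite -gm; exact: mg.
    by apply: rT (mg _ _ sI mI sm) _; rewrite gm; exact: mg'.
  + have [sI ->] := ki' _ sab sm; have [tI ->] := ki _ tab tm.
    by have := lt_le_trans st (le_trans tm sm); rewrite ltxx.
  + have [? ->] := ki' _ sab sm; have [? ->] := ki' _ tab tm; exact: mg'.
Qed.

Lemma d_length_ge a b g : (a < b)%R -> ldist X (g a) (g b) <= d_length a b g.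
Proof.
move=> ab; apply: ereal_sup_ubound; exists [:: b].
  exact: itv_partition1.
by rewrite subdivision_sum_cons subdivision_sum_nil adde0.
Qed.

Lemma tau_length_le a b g : (a < b)%R -> tau_length a b g <= tsep X (g a) (g b).
Proof.
move=> ab; apply: ereal_inf_lbound; exists [:: b].
  exact: itv_partition1.
by rewrite subdivision_sum_cons subdivision_sum_nil adde0.
Qed.

Lemma d_length_split a m b g : (a < m)%R -> (m < b)%R ->
  ldist X (g a) (g m) + d_length m b g <= d_length a b g.
Proof.
move=> am mb.
have dsum u v s : 0 <= subdivision_sum (ldist X) u v g s.
  by apply: sume_ge0 => i _; exact: (ldist_ge0 PX).
have -> : d_length m b g =
    esup0 [set subdivision_sum (ldist X) m b g s | s in itv_partition m b].
  apply/eqP; rewrite eq_le; apply/andP; split.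
    by apply: ge_ereal_sup => _ [s ms <-]; apply: esup0_ub; exists s.
  apply: esup0_le => [|_ [s ms <-]]; last first.
    by apply: ereal_sup_ubound; exists s.
  exact: le_trans (ldist_ge0 PX _ _) (d_length_ge g mb).
apply: esup0_addl; first exact: (ldist_ge0 PX).
- by exists (subdivision_sum (ldist X) m b g [:: b]), [:: b] => //;
    exact: itv_partition1.
- by move=> _ [s _ <-].
- move=> _ [s ms <-]; rewrite -subdivision_sum_cons.
  apply: ereal_sup_ubound; exists (m :: s) => //.
  by case: ms => h1 h2; split => //=; rewrite am.
Qed.

(** Adding [m] to a subdivision only lowers its sum, by the reverse triangle
    inequality, so the infimum may be taken over subdivisions through [m]. *)
Lemma tau_length_split a m b g : (a < m)%R -> (m < b)%R ->
  curve_monotone (caus X) a b g ->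
  tau_length a m g + tau_length m b g <= tau_length a b g.
Proof.
move=> am mb mg; apply: le_ereal_inf_tmp => _ [s abs <-].
suff [s1 [s2 [am1 mb2 le12]]] : exists s1 s2, [/\ itv_partition a m s1,
    itv_partition m b s2 &
    subdivision_sum (tsep X) a m g s1 + subdivision_sum (tsep X) m b g s2 <=
    subdivision_sum (tsep X) a b g s].
  apply: le_trans le12; apply: leeD; apply: ereal_inf_lbound;
  by [exists s1|exists s2].
elim: s a am mg abs => [|x s ih] a am mg.
  by move=> /itv_partition_nil ab; move: (lt_trans am mb); rewrite ab ltxx.
move=> /itv_partition_cons_itv[ax xb xs].
rewrite subdivision_sum_cons; have [xm|mx|xm] := ltgtP x m.
- have [|s1 [s2 [xm1 mb2 le12]]] := ih x xm _ xs.
    move=> u v; rewrite !in_itv /= => /andP[xu ub] /andP[xv vb].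
    by apply: mg; rewrite in_itv /= ?ub ?vb andbT (le_trans (ltW ax)).
  exists (x :: s1), s2; split => //.
    by case: xm1 => h1 h2; split => //=; rewrite ax.
  by rewrite subdivision_sum_cons -addeA leeD2l.
- exists [:: m], (x :: s); split; first exact: itv_partition1.
    by case: xs => h1 h2; split => //=; rewrite mx.
  rewrite !subdivision_sum_cons subdivision_sum_nil adde0 addeA leeD2r //.
  by apply: (tsep_reverse_triangle PX); apply: mg;
    rewrite ?in_itv /= ?lexx ?(ltW am) ?(ltW mb) ?(ltW ax)
      ?(ltW (lt_trans am mb)).
- exists [:: m], s; split; first exact: itv_partition1; rewrite -?xm //.
  by rewrite subdivision_sum_cons subdivision_sum_nil adde0.
Qed.

End Curves.

(** * Length spaces near a point *)

Section LengthSpaces.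
Context {R : realType} (X : lorentz_data R) (LX : lorentzian_length_space X).
Let PX := lls_prelength LX.
Implicit Types (x y z : X) (U V S : set X) (g : R -> X) (a b c : R).

(** Localizability provides a point in the timelike future of [x], and a
    timelike curve to it provides such points arbitrarily close to [x]. *)
Lemma lls_future_near x S : nbhs x S -> exists2 y, S y & chron X x y.
Proof.
move=> nS.
have [U nU [_ [w [_ _ _ fU _]]]] := lls_localizable LX x.
have [[y [xy _]] _] := fU _ (nbhs_singleton nU).
have [tl _] := lls_causally_path_connected LX.
have [a [b [g [[ab gl mg] ga gb]]]] := tl _ _ xy.
have aI : a \in `[a, b] by rewrite in_itv /= lexx ltW.
rewrite -ga in nS.
have [e e0 eS] := curve_near PX gl aI nS.
pose d := (Num.min (e / 2) (b - a))%R.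
have d0 : (0 < d)%R by rewrite lt_min divr_gt0 // subr_gt0.
have dI : (a + d)%R \in `[a, b].
  have db : (d <= b - a)%R by rewrite ge_min lexx orbT.
  by rewrite in_itv /=; lra.
exists (g (a + d)%R).
  apply: eS => //; rewrite addrAC subrr add0r gtr0_norm //.
  by rewrite gt_min ltr_pdivrMr // ltr_pMr // ltr1n.
by rewrite -ga; apply: mg => //; rewrite ltrDl.
Qed.

Lemma lls_past_near x S : nbhs x S -> exists2 y, S y & chron X y x.
Proof.
move=> nS.
have [U nU [_ [w [_ _ _ fU _]]]] := lls_localizable LX x.
have [_ [y [xy _]]] := fU _ (nbhs_singleton nU).
have [tl _] := lls_causally_path_connected LX.
have [a [b [g [[ab gl mg] ga gb]]]] := tl _ _ xy.
have bI : b \in `[a, b] by rewrite in_itv /= lexx ltW.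
rewrite -gb in nS.
have [e e0 eS] := curve_near PX gl bI nS.
pose d := (Num.min (e / 2) (b - a))%R.
have d0 : (0 < d)%R by rewrite lt_min divr_gt0 // subr_gt0.
have dI : (b - d)%R \in `[a, b].
  have db : (d <= b - a)%R by rewrite ge_min lexx orbT.
  by rewrite in_itv /=; lra.
exists (g (b - d)%R).
  apply: eS => //; rewrite addrAC subrr add0r normrN gtr0_norm //.
  by rewrite gt_min ltr_pdivrMr // ltr_pMr // ltr1n.
by rewrite -gb; apply: mg => //; rewrite ltrBlDr ltrDl.
Qed.

Lemma tau_length_le_tsep x y a b g : causal_curve_between x y a b g ->
  tau_length a b g <= tsep X x y.
Proof. by move=> [[ab _ _] <- <-]; exact: tau_length_le. Qed.

Lemma causal_curve_cst x : causal_curve 0 1 (fun _ : R => x).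
Proof.
split=> //; last by move=> s t _ _ _; exact: caus_refl.
move=> t _; exists 1%R => //; exists 0%R => s s' _ _ _ _.
by rewrite mul0r (ldistxx PX).
Qed.

(** The three properties are required of a nonempty [S] only: a neighbourhood
    in the amalgam may have an empty trace on one side. *)
Definition small S : Prop := forall x, S x ->
  [/\ exists2 U, S `<=` U & localizable_set U,
      exists2 U, S `<=` U & causally_closed U &
      exists2 U, S `<=` U & compact U].

Lemma small_subset U V : U `<=` V -> small V -> small U.
Proof.
move=> UV sV x /UV/sV[[U1 VU1 ?] [U2 VU2 ?] [U3 VU3 ?]]; split.
- by exists U1 => // y /UV/VU1.
- by exists U2 => // y /UV/VU2.
- by exists U3 => // y /UV/VU3.
Qed.

Lemma nbhs_small x : locally_compact [set: X] -> exists2 S, nbhs x S & small S.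
Proof.
move=> lc.
have [U1 n1 lU1] := lls_localizable LX x.
have [U2 n2 lU2] := lls_locally_causally_closed LX x.
have [U3 n3 [cU3 _]] := lc x I.
exists (U1 `&` U2 `&` U3).
  have {}n3 : nbhs x U3.
    have : \forall t \near x, [set: X] t -> U3 t by exact: n3.
    by apply: filterS => y; exact.
  by do 2 apply: filterI => //.
move=> y _; split.
- by exists U1 => // z [[]].
- by exists U2 => // z [[]].
- by exists U3 => // z [[]].
Qed.

Lemma nbhs_set_type U (p : U) (A : set U) : nbhs p A ->
  exists2 B : set X, nbhs (\val p) B & forall q : U, B (\val q) -> A q.
Proof.
rewrite nbhsE => -[W [[B oB <-] Bp] WA]; exists B; first exact: open_nbhs_nbhs.
by move=> q Bq; exact: WA.
Qed.

Section ConvexSmall.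
Variables (V : set X) (cV : causally_convex V) (sV : small V).

Lemma small_d_length : exists2 C : R, (0 <= C)%R & forall a b g,
  causal_curve a b g -> curve_in V a b g -> d_length a b g <= C%:E.
Proof.
have [[x /sV[[U VU [[C C0 UC] _]] _ _]]|nV] := pselect (V !=set0).
  exists C; first exact: ltW.
  by move=> a b g cg gV; apply: UC => // t /gV/VU.
exists 0%R => // a b g [ab _ _] gV; exfalso; apply: nV.
by exists (g a); apply: gV; rewrite in_itv /= lexx ltW.
Qed.

(** Convexity forces every causal curve between points of [V] to stay in the
    ambient localizable set, so the local time separation of that set is the
    global one. *)
Lemma small_localized x0 : V x0 -> exists U (w : U -> U -> R), [/\ V `<=` U,
  continuous (fun pq : U * U => w pq.1 pq.2),
  (forall p q : U, V (\val p) -> V (\val q) ->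
     tsep X (\val p) (\val q) = (w p q)%:E) &
  (forall p q, V p -> V q -> caus X p q ->
     exists a b g, causal_curve_between p q a b g /\
       tau_length a b g = tsep X p q)].
Proof.
move=> /sV[[U VU [_ [w [w0 cw Pw _ mw]]]] _ _].
have wE p q : V (\val p) -> V (\val q) ->
    tsep X (\val p) (\val q) = (w p q)%:E /\ (caus X (\val p) (\val q) ->
    exists a b g, causal_curve_between (\val p) (\val q) a b g /\
       tau_length a b g = (w p q)%:E).
  move=> Vp Vq; have [pq|npq] := pselect (caus X (\val p) (\val q)).
    have [a [b [g [[cg gU mg] lg]]]] := mw _ _ pq.
    split; last by exists a, b, g.
    apply/eqP; rewrite (lls_intrinsic LX) eq_le; apply/andP; split; last first.
      by apply: esup0_ub; exists a, b, g.
    apply: esup0_le => [|_ [a' [b' [g' [cg' ->]]]]]; first by rewrite lee_fin.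
    rewrite -lg; apply: mg => // t tI; apply: VU.
    have [cg1 ga gb] := cg'.
    by apply: (causal_curve_in PX cV _ _ cg1) => //; rewrite ?ga ?gb.
  split => //; rewrite (tsep_not_caus PX) //.
  apply/esym/eqP; rewrite eqe eq_le w0 andbT leNgt; apply/negP => wpq.
  apply: npq; have := tsep_gt0 Pw p q; rewrite /= lte_fin => -[/(_ wpq) h _].
  exact: chron_caus h.
exists U, w; split => //; first by move=> p q Vp Vq; have [] := wE p q Vp Vq.
move=> p q Vp Vq pq.
pose P : U := exist _ p (mem_set (VU _ Vp)).
pose Q : U := exist _ q (mem_set (VU _ Vq)).
have [e /(_ pq)[a [b [g [cg lg]]]]] := wE P Q Vp Vq.
by exists a, b, g; split => //; rewrite lg -e.
Qed.

Lemma small_maximal p q : V p -> V q -> caus X p q ->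
  exists a b g, causal_curve_between p q a b g /\ tau_length a b g = tsep X p q.
Proof. by move=> Vp; have [U [w [_ _ _]]] := small_localized Vp; apply. Qed.

Lemma small_fin p q : V p -> V q -> tsep X p q \is a fin_num.
Proof.
move=> Vp Vq; have [U [w [VU _ h _]]] := small_localized Vp.
pose P : U := exist _ p (mem_set (VU _ Vp)).
pose Q : U := exist _ q (mem_set (VU _ Vq)).
by have -> : tsep X p q = (w P Q)%:E by exact: (h P Q).
Qed.

Lemma small_usc p q c : open V -> V p -> V q -> tsep X p q < c%:E ->
  \forall p' \near p & q' \near q, tsep X p' q' < c%:E.
Proof.
move=> oV Vp Vq; have [U [w [VU cw h _]]] := small_localized Vp.
pose P : U := exist _ p (mem_set (VU _ Vp)).
pose Q : U := exist _ q (mem_set (VU _ Vq)).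
have -> : tsep X p q = (w P Q)%:E by exact: (h P Q).
rewrite lte_fin => wc.
have /(cw (P, Q)) : nbhs (w P Q) [set r : R | (r < c)%R] by exact: lt_nbhsl.
move=> [[A B] /= [/nbhs_set_type[A' nA' A'A] /nbhs_set_type[B' nB' B'B]] AB].
have nV r : V r -> nbhs r V by move=> Vr; exact: open_nbhs_nbhs.
exists (A' `&` V, B' `&` V).
  by split; apply: filterI => //; exact: nV.
move=> [p' q'] [[A'p' Vp'] [B'q' Vq']] /=.
pose P' : U := exist _ p' (mem_set (VU _ Vp')).
pose Q' : U := exist _ q' (mem_set (VU _ Vq')).
have -> : tsep X p' q' = (w P' Q')%:E by exact: (h P' Q').
rewrite lte_fin; apply: (AB (P', Q')); split; [exact: A'A|exact: B'B].
Qed.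

(** Turns the uniform bound on lengths into a function of points.  Unlike that
    bound, the rate at which the function drops ([length_potential_drop]) can be
    added up over the sides of an amalgam. *)
Definition length_potential x : \bar R :=
  esup0 [set l | exists a b g, [/\ causal_curve a b g, curve_in V a b g,
    g a = x & l = d_length a b g]].

Lemma length_potential_le C : (0 <= C)%R -> (forall a b g,
  causal_curve a b g -> curve_in V a b g -> d_length a b g <= C%:E) ->
  forall x, length_potential x <= C%:E.
Proof.
move=> C0 VC x; apply: esup0_le; first by rewrite lee_fin.
by move=> _ [a [b [g [cg gV _ ->]]]]; exact: VC.
Qed.

(** A curve issuing from [y] can be prolonged backwards by one from [x] to
    [y]. *)
Lemma length_potential_drop x y : V x -> V y -> caus X x y ->
  ldist X x y + length_potential y <= length_potential x.
Proof.
move=> Vx Vy xy; apply: esup0_addl; first exact: (ldist_ge0 PX).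
- exists (d_length 0%R 1%R (fun _ : R => y)), 0%R, 1%R, (fun _ => y).
  split => //.
  exact: causal_curve_cst.
- move=> _ [a [b [g [[ab _ _] _ _ ->]]]].
  exact: le_trans (ldist_ge0 PX _ _) (d_length_ge _ ab).
move=> _ [a [b [g [cg gV ga ->]]]].
have [_ cc] := lls_causally_path_connected LX.
have [a0 [m [h [ch ha hm]]]] := cc _ _ xy.
have [b' [g' [cg' g'm g'b tl dl]]] :=
  rel_curve_translate m (cg : rel_curve (caus X) a b g).
have hg : h m = g' m by rewrite hm g'm ga.
have [am _ _] := ch; have [mb _ _] := cg'.
have ck : causal_curve a0 b' (curve_concat m h g').
  exact: (rel_curve_concat PX (caus_trans PX)).
have bI : b \in `[a, b] by have [ab _ _] := cg; rewrite in_itv /= lexx ltW.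
have ka : curve_concat m h g' a0 = x by rewrite curve_concatl ?ltW.
have kb : curve_concat m h g' b' = g b by rewrite curve_concatr ?ltW.
apply: (@le_trans _ _ (d_length a0 b' (curve_concat m h g'))); last first.
  apply: esup0_ub; exists a0, b', (curve_concat m h g'); split => //.
  apply: (causal_curve_in PX cV _ _ ck); rewrite ?ka ?kb //.
  exact: gV.
apply: le_trans (d_length_split PX (curve_concat m h g') am mb).
rewrite ka [curve_concat m h g' m]curve_concatl // hm leeD2l //.
rewrite -dl (_ : d_length m b' g' = d_length m b' (curve_concat m h g')) //.
apply: eq_d_length => t t'; rewrite !in_itv /= => /andP[mt _] /andP[mt' _].
by rewrite !curve_concatr.
Qed.

End ConvexSmall.

End LengthSpaces.

(** * Spaces glued along a seam *)

Section Gluing.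
Context {R : realType} (X : bool -> lorentz_data R) (Y : lorentz_data R).
Context (iota : forall i, X i -> Y).
Arguments iota {i} _.

(** What the arguments below use of an amalgam.  Crossings of the seam are pairs
    [a], [b] with [iota a = iota b]; allowing them to lie on the same side,
    where [a = b], makes one statement cover points of the same and of
    different sides.  [gl_nbhs] and [gl_trace] together say that [Y] carries the
    quotient topology and that both sides are closed subspaces of it. *)
Record glued : Prop := {
  gl_lls : forall i, lorentzian_length_space (X i);
  gl_strongly_causal : forall i, strongly_causal (X i);
  gl_locally_compact : forall i, locally_compact [set: X i];
  gl_ldist_ge0 : forall p q : Y, 0 <= ldist Y p q;
  gl_ldist_eq0 : forall p q : Y, ldist Y p q = 0 <-> p = q;
  gl_ldist_sym : forall p q : Y, ldist Y p q = ldist Y q p;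
  gl_ldist_triangle : forall p q r : Y,
    ldist Y p r <= ldist Y p q + ldist Y q r;
  gl_surj : forall p, exists i (x : X i), iota x = p;
  gl_inj : forall i, injective (@iota i);
  gl_dist : forall i (x y : X i),
    ldist Y (iota x) (iota y) <= ldist (X i) x y;
  gl_nbhs : forall p N, (forall i (x : X i), iota x = p ->
    nbhs x (@iota i @^-1` N)) -> nbhs p N;
  gl_trace : forall i j (y : X j) (S : set (X i)),
    (forall x, iota x = iota y -> nbhs x S) ->
    nbhs y [set y' | forall x' : X i, iota x' = iota y' -> S x'];
  gl_caus : forall i j (x : X i) (y : X j), caus Y (iota x) (iota y) <->
    exists a b, [/\ iota a = iota b, caus (X i) x a & caus (X j) b y];
  gl_tsep_ge0 : forall p q : Y, 0 <= tsep Y p q;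
  gl_tsep_ge : forall i j (x : X i) (y : X j) a b, iota a = iota b ->
    caus (X i) x a -> caus (X j) b y ->
    tsep (X i) x a + tsep (X j) b y <= tsep Y (iota x) (iota y);
  gl_tsep_gt : forall i j (x : X i) (y : X j) c, 0 <= c ->
    c < tsep Y (iota x) (iota y) -> exists a b,
    [/\ iota a = iota b, caus (X i) x a, caus (X j) b y &
        c < tsep (X i) x a + tsep (X j) b y];
  gl_chron : forall p q, chron Y p q <-> 0 < tsep Y p q;
  gl_future : forall i j (x : X i) (y : X j) (S : set (X i)),
    iota x = iota y -> nbhs x S ->
    exists a (b : X j), [/\ iota a = iota b, S a & chron (X i) x a];
  gl_past : forall i j (x : X i) (y : X j) (S : set (X i)),
    iota x = iota y -> nbhs x S ->
    exists a (b : X j), [/\ iota a = iota b, S a & chron (X i) a x] }.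

Context (G : glued).
Let LX i := gl_lls G i.
Let PX i := lls_prelength (LX i).

Lemma iota_nbhs i (x : X i) N : nbhs (iota x) N -> nbhs x (@iota i @^-1` N).
Proof.
rewrite nbhsE => -[B [oB Bx] BN]; have [e e0 eB] := oB _ Bx.
apply/(nbhs_ldistP (PX i)); exists e => // y xy; apply/BN/eB.
exact: le_lt_trans (gl_dist G _ _) xy.
Qed.

Lemma iota_trace i p (S : set (X i)) : (forall x, iota x = p -> nbhs x S) ->
  nbhs p [set p' | forall x, iota x = p' -> S x].
Proof.
by move=> pS; apply: (gl_nbhs G) => j y yp; apply: (gl_trace G); rewrite yp.
Qed.

Lemma caus_iota i (x y : X i) : caus Y (iota x) (iota y) <-> caus (X i) x y.
Proof.
split=> [/(gl_caus G)[a [b [/(gl_inj G)-> xb]]]|xy].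
  exact: (caus_trans (PX i)).
by apply/(gl_caus G); exists x, x; split => //; exact: (caus_refl (PX i)).
Qed.

Lemma tsep_iota i (x y : X i) : tsep Y (iota x) (iota y) = tsep (X i) x y.
Proof.
apply/eqP; rewrite eq_le; apply/andP; split.
  rewrite leNgt; apply/negP.
  move=> /(gl_tsep_gt G (tsep_ge0 (PX i) _ _))[a [b [/(gl_inj G)-> xb yb]]].
  by rewrite ltNge (tsep_reverse_triangle (PX i)).
have [xy|nxy] := pselect (caus (X i) x y); last first.
  by rewrite (tsep_not_caus (PX i)) // (gl_tsep_ge0 G).
have xx := caus_refl (PX i) x.
apply: le_trans (gl_tsep_ge G erefl xx xy).
by rewrite leeDr // (tsep_ge0 (PX i)).
Qed.

Lemma chron_iota i (x y : X i) : chron Y (iota x) (iota y) <-> chron (X i) x y.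
Proof.
split=> [/(gl_chron G)|/(tsep_gt0 (PX i))] h.
  by apply/(tsep_gt0 (PX i)); rewrite -tsep_iota.
by apply/(gl_chron G); rewrite tsep_iota.
Qed.

Lemma transfer i j (a a' : X i) (b b' : X j) :
  iota a = iota b -> iota a' = iota b' ->
  (caus (X i) a a' -> caus (X j) b b') /\ tsep (X i) a a' = tsep (X j) b b'.
Proof.
move=> ab ab'; split; last by rewrite -!tsep_iota ab ab'.
by move/caus_iota; rewrite ab ab' => /caus_iota.
Qed.

(** Among three sides two agree, which is why one crossing of the seam is always
    enough: a passage through the other side between two points of the seam can
    be replaced by the direct relation. *)
Lemma cross_twice i j k (x a : X i) (b c : X j) (d z : X k) :
  iota a = iota b -> iota c = iota d ->
  caus (X i) x a -> caus (X j) b c -> caus (X k) d z ->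
  caus Y (iota x) (iota z) /\
  tsep (X i) x a + (tsep (X j) b c + tsep (X k) d z) <=
    tsep Y (iota x) (iota z).
Proof.
move=> ab cd xa bc dz.
have [E|[E|E]] : i = j \/ j = k \/ i = k.
- by case: (i) (j) (k) => [] [] []; [left|left|right;right|right;left|
    right;left|right;right|left|left].
- subst j; have := gl_inj G ab; move=> {}ab; subst b.
  have xc := caus_trans (PX i) xa bc.
  split; first by apply/(gl_caus G); exists c, d.
  apply: le_trans (gl_tsep_ge G cd xc dz).
  by rewrite addeA leeD2r // (tsep_reverse_triangle (PX i)).
- subst k; have := gl_inj G cd; move=> {}cd; subst d.
  have bz := caus_trans (PX j) bc dz.
  split; first by apply/(gl_caus G); exists a, b.
  apply: le_trans (gl_tsep_ge G ab xa bz).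
  by rewrite leeD2l // (tsep_reverse_triangle (PX j)).
- subst k; have [ad ->] := transfer (esym ab) cd.
  have {}ad := ad bc; have xd := caus_trans (PX i) xa ad.
  split; first by apply/caus_iota; exact: caus_trans dz.
  rewrite tsep_iota addeA.
  apply: le_trans (tsep_reverse_triangle (PX i) xd dz).
  by rewrite leeD2r // (tsep_reverse_triangle (PX i)).
Qed.

Lemma glued_caus_trans (p q r : Y) : caus Y p q -> caus Y q r -> caus Y p r.
Proof.
have [i [x <-]] := gl_surj G p; have [j [y <-]] := gl_surj G q.
have [k [z <-]] := gl_surj G r.
move=> /(gl_caus G)[a [b [ab xa by_]]] /(gl_caus G)[c [d [cd yc dz]]].
by have [] := cross_twice ab cd xa (caus_trans (PX j) by_ yc) dz.
Qed.

Lemma tsep_esup0 i j (x : X i) (y : X j) : tsep Y (iota x) (iota y) =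
  esup0 [set l | exists a b, [/\ iota a = iota b, caus (X i) x a,
    caus (X j) b y & l = tsep (X i) x a + tsep (X j) b y]].
Proof.
apply/eqP; rewrite eq_le; apply/andP; split.
  rewrite leNgt; apply/negP => /(gl_tsep_gt G (esup0_ge0 _))[a [b [ab xa yb]]].
  by rewrite ltNge esup0_ub //; exists a, b.
apply: esup0_le; first exact: (gl_tsep_ge0 G).
by move=> _ [a [b [ab xa yb ->]]]; exact: (gl_tsep_ge G).
Qed.

Lemma glued_reverse_triangle (p q r : Y) : caus Y p q -> caus Y q r ->
  tsep Y p q + tsep Y q r <= tsep Y p r.
Proof.
have [i [x <-]] := gl_surj G p; have [j [y <-]] := gl_surj G q.
have [k [z <-]] := gl_surj G r.
move=> /(gl_caus G)[a [b [ab xa by_]]] /(gl_caus G)[c [d [cd yc dz]]].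
rewrite (tsep_esup0 x y) (tsep_esup0 y z); apply: esup0_sup_add.
- by exists (tsep (X i) x a + tsep (X j) b y), a, b.
- by exists (tsep (X j) y c + tsep (X k) d z), c, d.
- by move=> _ [? [? [_ _ _ ->]]]; rewrite adde_ge0 ?(tsep_ge0 (PX _)).
- by move=> _ [? [? [_ _ _ ->]]]; rewrite adde_ge0 ?(tsep_ge0 (PX _)).
move=> _ _ [a' [b' [ab' xa' by' ->]]] [c' [d' [cd' yc' dz' ->]]].
have [_ +] := cross_twice ab' cd' xa' (caus_trans (PX j) by' yc') dz'.
apply: le_trans; rewrite -addeA leeD2l // addeA leeD2r //.
exact: (tsep_reverse_triangle (PX j)).
Qed.

(** If one of the two pieces of a nearly optimal broken path is null, then
    sliding the crossing point along the seam, which is possible because the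
    seam is nowhere timelike isolated, makes both pieces timelike. *)
Lemma timelike_crossing i j (x : X i) (y : X j) (c : R) : (0 <= c)%R ->
  c%:E < tsep Y (iota x) (iota y) -> exists a b,
    [/\ iota a = iota b, chron (X i) x a, chron (X j) b y &
        c%:E < tsep (X i) x a + tsep (X j) b y].
Proof.
move=> c0 /(gl_tsep_gt G _)[|a [b [ab xa yb cxy]]]; first by rewrite lee_fin.
have tx := tsep_ge0 (PX i); have ty := tsep_ge0 (PX j).
have [xa0|] := eqVneq (tsep (X i) x a) 0.
  rewrite xa0 add0e in cxy.
  have [b' [a' [ba' cb bb']]] := gl_future G (esym ab) (tsep_near_l (PX j) cxy).
  have aa' : chron (X i) a a'.
    by apply/chron_iota; rewrite ab -ba'; exact/chron_iota.
  exists a', b'; split => //.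
  - exact: (caus_chron (PX i)) aa'.
  - by apply/(tsep_gt0 (PX j)); apply: le_lt_trans cb; rewrite lee_fin.
  - by apply: lt_le_trans cb _; rewrite leeDr.
move=> xa1; have {xa1} : 0 < tsep (X i) x a by rewrite lt0e xa1 tx.
move=> /(tsep_gt0 (PX i)) xa0.
have [by0|yb1] := eqVneq (tsep (X j) b y) 0; last first.
  exists a, b; split => //; apply/(tsep_gt0 (PX j)).
  by rewrite lt0e yb1 ty.
rewrite by0 adde0 in cxy.
have [a' [b' [ab' ca aa']]] := gl_past G ab (tsep_near_r (PX i) cxy).
have bb' : chron (X j) b' b.
  by apply/chron_iota; rewrite -ab -ab'; exact/chron_iota.
exists a', b'; split => //.
- by apply/(tsep_gt0 (PX i)); apply: le_lt_trans ca; rewrite lee_fin.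
- exact: (chron_caus_trans (PX j)) bb' yb.
- by apply: lt_le_trans ca _; rewrite leeDl.
Qed.

(** A property of pairs may be checked on each of the four pairs of sides: a
    side that misses [p] misses a neighbourhood of [p]. *)
Lemma near_iota2 (p q : Y) (P : Y -> Y -> Prop) :
  (forall i j (x : X i) (y : X j), iota x = p -> iota y = q ->
    \forall x' \near x & y' \near y, P (iota x') (iota y')) ->
  \forall p' \near p & q' \near q, P p' q'.
Proof.
move=> h.
have : \forall z \near (p, q), forall ij : bool * bool,
    forall (x : X ij.1) (y : X ij.2), iota x = z.1 -> iota y = z.2 ->
    P (iota x) (iota y).
  apply: (@filter_forall _ (bool * bool)%type
    (fun ij z => forall (x : X ij.1) (y : X ij.2), iota x = z.1 ->
       iota y = z.2 -> P (iota x) (iota y)) (nbhs (p, q))) => -[i j] /=.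
  suff [N [M [pN qM NM]]] : exists N M, [/\ nbhs p N, nbhs q M &
      forall (x : X i) (y : X j), N (iota x) -> M (iota y) ->
        P (iota x) (iota y)].
    exists (N, M) => //= -[p' q'] [/= Np Mq] x y xp yq.
    by apply: NM; rewrite ?xp ?yq.
  have [[x xp]|nx] := pselect (exists x : X i, iota x = p); last first.
    exists [set p' | forall x : X i, iota x = p' -> set0 x], setT; split.
    - by apply: iota_trace => x xp; exfalso; apply: nx; exists x.
    - exact: filterT.
    - by move=> x y /(_ x erefl).
  have [[y yq]|ny] := pselect (exists y : X j, iota y = q); last first.
    exists setT, [set q' | forall y : X j, iota y = q' -> set0 y]; split.
    - exact: filterT.
    - by apply: iota_trace => y yp; exfalso; apply: ny; exists y.
    - by move=> x' y _ /(_ y erefl).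
  have [[A B] /= [nA nB] AB] := h i j x y xp yq.
  exists [set p' | forall x : X i, iota x = p' -> A x],
         [set q' | forall y : X j, iota y = q' -> B y]; split.
  - by apply: iota_trace => x'; rewrite -xp => /(gl_inj G) ->.
  - by apply: iota_trace => y'; rewrite -yq => /(gl_inj G) ->.
  - by move=> x' y' /(_ x' erefl) Ax /(_ y' erefl) By; exact: (AB (x', y')).
apply: filterS => -[p' q'] /= PP.
have [i [x xp]] := gl_surj G p'; have [j [y yq]] := gl_surj G q'.
by have := PP (i, j) x y xp yq; rewrite xp yq.
Qed.

Lemma glued_lsc : lower_semicontinuous (fun z : Y * Y => tsep Y z.1 z.2).
Proof.
move=> [p q] c /= cpq; exists [set z | c%:E < tsep Y z.1 z.2] => //.
apply: (near_iota2 (P := fun p' q' => c%:E < tsep Y p' q')) => i j x y /= xp yq.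
rewrite -xp -yq {p q xp yq} in cpq.
have tx := tsep_ge0 (PX i); have ty := tsep_ge0 (PX j).
have [c0|c0] := ltP c 0%R.
  by near=> x' y'; apply: lt_le_trans (gl_tsep_ge0 G _ _); rewrite lte_fin.
have [a [b [ab xa yb cab]]] := timelike_crossing c0 cpq.
have [||u [v [uxa vby u0 v0 cuv]]] := lte_add_split cab.
- exact/(tsep_gt0 (PX i)).
- exact/(tsep_gt0 (PX j)).
have nA := tsep_near_l (PX i) uxa; have nB := tsep_near_r (PX j) vby.
exists ([set x' | u%:E < tsep (X i) x' a], [set y' | v%:E < tsep (X j) b y']).
  by [].
move=> [x' y'] [/= ux vy].
apply: lt_le_trans (gl_tsep_ge G ab _ _).
- by apply: le_lt_trans (lteD ux vy); rewrite lee_fin.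
- apply: (chron_caus (PX i)); apply/(tsep_gt0 (PX i)).
  by apply: le_lt_trans ux; rewrite lee_fin.
- apply: (chron_caus (PX j)); apply/(tsep_gt0 (PX j)).
  by apply: le_lt_trans vy; rewrite lee_fin.
Unshelve. all: by end_near.
Qed.

Lemma glued_prelength : lorentzian_prelength Y.
Proof.
have chron_caus p q : chron Y p q -> caus Y p q.
  have [i [x <-]] := gl_surj G p; have [j [y <-]] := gl_surj G q.
  move=> /(gl_chron G)/(gl_tsep_gt G (lexx _))[a [b [ab xa yb _]]].
  by apply/(gl_caus G); exists a, b.
split.
- exact: gl_ldist_ge0.
- exact: gl_ldist_eq0.
- exact: gl_ldist_sym.
- exact: gl_ldist_triangle.
- move=> p; have [i [x <-]] := gl_surj G p.
  exact/caus_iota/(caus_refl (PX i)).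
- exact: glued_caus_trans.
- move=> p q r pq qr; apply/(gl_chron G).
  have := glued_reverse_triangle (chron_caus _ _ pq) (chron_caus _ _ qr).
  apply: lt_le_trans.
  move: pq qr => /(gl_chron G) pq /(gl_chron G) qr.
  by rewrite adde_gt0.
- exact: chron_caus.
- exact: gl_tsep_ge0.
- exact: glued_lsc.
- exact: glued_reverse_triangle.
- by move=> p q; split=> /(gl_chron G).
Qed.

Let PY := glued_prelength.

Lemma rel_curve_iota i (r : X i -> X i -> Prop) (r' : Y -> Y -> Prop) a b g :
  (forall x y, r x y -> r' (iota x) (iota y)) ->
  rel_curve r a b g -> rel_curve r' a b (iota \o g).
Proof.
move=> rr' [ab gl mg]; split => //.
  move=> t tab; have [e e0 [L gL]] := gl _ tab; exists e => //; exists L.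
  move=> s s' sab sab' se se'; apply: le_trans (gL _ _ sab sab' se se').
  exact: gl_dist.
by move=> s t sab tab st; exact/rr'/mg.
Qed.

Lemma curve_across (r : forall i, X i -> X i -> Prop) (r' : Y -> Y -> Prop)
    i j (g : R -> X i) (h : R -> X j) a b c d :
  (forall p q s, r' p q -> r' q s -> r' p s) ->
  (forall i (x y : X i), r i x y -> r' (iota x) (iota y)) ->
  (forall p q, r' p q -> caus Y p q) ->
  rel_curve (r i) a b g -> rel_curve (r j) c d h -> iota (g b) = iota (h c) ->
  exists u v k, [/\ rel_curve r' u v k, k u = iota (g a), k v = iota (h d) &
    tau_length a b g + tau_length c d h <= tau_length u v k].
Proof.
move=> rT rr' rc cg ch gh.
have := rel_curve_iota (rr' i) cg; set g' := _ \o g => cg'.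
have := rel_curve_iota (rr' j) ch; set h' := _ \o h => ch'.
have [v [k [ck kb kv lk _]]] := rel_curve_translate b ch'.
have gk : g' b = k b by rewrite kb.
have cc := rel_curve_concat PY rT cg' ck gk.
have [ab _ _] := cg'; have [bv _ _] := ck.
exists a, v, (curve_concat b g' k); split => //.
- by rewrite curve_concatl // ltW.
- by rewrite curve_concatr // ?kv // ltW.
have -> : tau_length a b g = tau_length a b (curve_concat b g' k).
  apply: eq_tau_length => t t'; rewrite !in_itv /= => /andP[_ tb] /andP[_ tb'].
  by rewrite !curve_concatl // tsep_iota.
have -> : tau_length c d h = tau_length b v (curve_concat b g' k).
  transitivity (tau_length c d h').
    by apply: eq_tau_length => t t' _ _; rewrite tsep_iota.
  rewrite -lk; apply: eq_tau_length => t t'; rewrite !in_itv /=.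
  by move=> /andP[tb _] /andP[tb' _]; rewrite !curve_concatr.
apply: (tau_length_split PY) => // s t sI tI st.
by have [_ _ mk] := cc; exact/rc/mk.
Qed.

Lemma causal_curve_across i j (x a : X i) (b y : X j) s t g s' t' g' :
  iota a = iota b -> causal_curve_between x a s t g ->
  causal_curve_between b y s' t' g' ->
  exists u v k, causal_curve_between (iota x) (iota y) u v k /\
    tau_length s t g + tau_length s' t' g' <= tau_length u v k.
Proof.
move=> ab [cg gs gt] [cg' gs' gt'].
have [||u [v [k [ck ku kv lk]]]] := @curve_across (fun i => caus (X i))
  (caus Y) i j g g' s t s' t' (caus_trans PY) _ (fun p q pq => pq) cg cg'.
- by move=> l x' y' /caus_iota.
- by rewrite gt gs'.
by exists u, v, k; split => //; split => //; rewrite ?ku ?kv ?gs ?gt'.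
Qed.

Lemma glued_path_connected : causally_path_connected Y.
Proof.
split=> p q; have [i [x <-]] := gl_surj G p; have [j [y <-]] := gl_surj G q.
- move=> /(gl_chron G)/(timelike_crossing (lexx _))[a [b [ab xa yb _]]].
  have [tl _] := lls_causally_path_connected (LX i).
  have [s [t [g [cg gs gt]]]] := tl _ _ xa.
  have [tl' _] := lls_causally_path_connected (LX j).
  have [s' [t' [g' [cg' gs' gt']]]] := tl' _ _ yb.
  have [||u [v [k [ck ku kv _]]]] := @curve_across (fun i => chron (X i))
    (chron Y) i j g g' s t s' t' (chron_trans PY) _ (chron_caus PY) cg cg'.
  + by move=> l x' y' /chron_iota.
  + by rewrite gt gs'.
  by exists u, v, k; split => //; rewrite ?ku ?kv ?gs ?gt'.
- move=> /(gl_caus G)[a [b [ab xa yb]]].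
  have [_ cc] := lls_causally_path_connected (LX i).
  have [_ cc'] := lls_causally_path_connected (LX j).
  have [s [t [g cg]]] := cc _ _ xa; have [s' [t' [g' cg']]] := cc' _ _ yb.
  have [u [v [k [ck _]]]] := causal_curve_across ab cg cg'.
  by exists u, v, k.
Qed.

Lemma glued_intrinsic : intrinsic Y.
Proof.
move=> p q; have [i [x <-]] := gl_surj G p; have [j [y <-]] := gl_surj G q.
apply/eqP; rewrite eq_le; apply/andP; split; last first.
  apply: esup0_le; first exact: (tsep_ge0 PY).
  by move=> _ [a [b [g [cg ->]]]]; exact: tau_length_le_tsep.
rewrite leNgt; apply/negP => /(gl_tsep_gt G (esup0_ge0 _))[a [b [ab xa yb]]].
apply/negP; rewrite -leNgt (lls_intrinsic (LX i)) (lls_intrinsic (LX j)).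
have len0 l (u v : R) (g : R -> X l) : 0 <= tau_length u v g.
  apply: le_ereal_inf_tmp => _ [s _ <-]; apply: sume_ge0 => n _.
  exact: (tsep_ge0 (PX l)).
have [_ cc] := lls_causally_path_connected (LX i).
have [_ cc'] := lls_causally_path_connected (LX j).
apply: esup0_sup_add.
- by have [s [t [g cg]]] := cc _ _ xa; exists (tau_length s t g), s, t, g.
- by have [s [t [g cg]]] := cc' _ _ yb; exists (tau_length s t g), s, t, g.
- by move=> _ [s [t [g [_ ->]]]].
- by move=> _ [s [t [g [_ ->]]]].
move=> _ _ [s [t [g [cg ->]]]] [s' [t' [g' [cg' ->]]]].
have [u [v [k [ck /le_trans]]]] := causal_curve_across ab cg cg'.
by apply; apply: esup0_ub; exists u, v, k.
Qed.

(** ** Small convex neighbourhoods *)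

(** The vertices of a diamond being on side [i], the diamond of the amalgam
    meets side [i] in the diamond of that side. *)
Lemma convex_nbhs_side i (x : X i) (S : set (X i)) : nbhs x S ->
  exists V, [/\ open V, V (iota x), causally_convex V &
    forall x', V (iota x') -> S x'].
Proof.
rewrite nbhsE => -[B [oB Bx] BS]; move: oB.
rewrite (gl_strongly_causal G i) => -[F FI BE].
move: Bx; rewrite -BE => -[C FC Cx].
have [D _ CE] := FI _ FC; rewrite -CE in Cx.
exists [set p | forall d, d \in D -> diamond (iota d.1) (iota d.2) p]; split.
- rewrite openE => p Vp; apply: (filter_bigI (D := D)) => d dD.
  by apply: open_nbhs_nbhs; split; [exact: (open_diamond PY)|exact: Vp].
- by move=> d dD; have [] := Cx d dD; split; exact/chron_iota.
- move=> p q r Vp Vr pq qr d dD.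
  by apply: (causally_convex_diamond PY _ _ pq qr); [exact: Vp|exact: Vr].
- move=> x' Vx'; apply: BS; rewrite -BE; exists C => //; rewrite -CE => d dD.
  by have [h1 h2] := Vx' d dD; split; apply/chron_iota.
Qed.

Lemma open_off_side i : open [set p | forall x : X i, iota x <> p].
Proof.
rewrite openE => p px.
have := @iota_trace i p set0 (fun x xp => False_ind _ (px x xp)).
by apply: filterS => p' h x xp'; exact: h x xp'.
Qed.

(** The point is the case of a [p] off side [i]: there it has a convex
    neighbourhood that avoids side [i], because a causal relation into that side
    passes through the seam, which stays outside a small convex set. *)
Lemma convex_nbhs_trace i p (S : set (X i)) :
  (forall x : X i, iota x = p -> nbhs x S) ->
  exists V, [/\ open V, V p, causally_convex V &
    forall x : X i, V (iota x) -> S x].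
Proof.
move=> pS; have [[x xp]|nx] := pselect (exists x : X i, iota x = p).
  have [V [oV Vx cV VS]] := convex_nbhs_side (pS _ xp).
  by exists V; rewrite -xp.
have off j q (y : X j) : (forall x : X i, iota x <> q) -> iota y = q ->
    j = ~~ i.
  move=> nq yq; have [E|] := eqVneq j i; last by case: (j) (i) => [] [].
  by subst j; case: (nq y).
have [j [y yp]] := gl_surj G p.
have np (x : X i) : iota x <> p by move=> xp; apply: nx; exists x.
have jE := off _ _ _ np yp.
have nS : nbhs y [set y' : X j | forall x : X i, iota x = iota y' -> False].
  by apply: (gl_trace G (S := set0)) => x; rewrite yp => /np.
have [V [oV Vy cV VS]] := convex_nbhs_side nS.
exists (V `&` [set q | forall x : X i, iota x <> q]); split.
- by apply: openI oV _; exact: open_off_side.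
- by rewrite -yp; split => // x; rewrite yp; exact: np.
- move=> q1 q q2 [Vq1 n1] [Vq2 n2] q1q qq2; split; first exact: cV q1q qq2.
  move=> x xq; have [k [z zq1]] := gl_surj G q1.
  have kE := off _ _ _ n1 zq1; rewrite -jE in kE; subst k.
  move: q1q; rewrite -zq1 -xq => /(gl_caus G)[a [b [ab za bx]]].
  apply: (VS a _ b (esym ab)); apply: (cV q1 _ q2) => //.
    by rewrite -zq1; apply/caus_iota.
  by apply: caus_trans PY _ _ _ _ qq2; rewrite ab -xq; exact/caus_iota.
- by move=> x [_ /(_ x)].
Qed.

Lemma small_convex_nbhs p N : nbhs p N -> exists V, [/\ open V, V p,
  causally_convex V, V `<=` N & forall i, small (@iota i @^-1` V)].
Proof.
move=> nN.
have side i : exists S : set (X i),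
    (forall x : X i, iota x = p -> nbhs x S) /\ small S.
  have [[x xp]|nx] := pselect (exists x : X i, iota x = p); last first.
    exists set0; split => // x xp.
    by exfalso; apply: nx; exists x.
  have [S nS sS] := nbhs_small (LX i) x (gl_locally_compact G (i:=i)).
  by exists S; split => // x'; rewrite -xp => /(gl_inj G) ->.
have trace i : exists V, [/\ open V, V p, causally_convex V &
    forall x : X i, V (iota x) -> N (iota x) /\ exists S : set (X i),
      S x /\ small S /\ (forall x' : X i, V (iota x') -> S x')].
  have [S [nS sS]] := side i.
  have [x xp|V [oV Vp cV VS]] :=
      @convex_nbhs_trace i p ((@iota i @^-1` N) `&` S) _.
    by apply: filterI (nS _ xp); apply: iota_nbhs; rewrite xp.
  exists V; split => // x /VS[Nx Sx]; split => //; exists S; split => //.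
  by split => // x' /VS[].
have [V [oV Vp cV VN]] := trace true; have [W [oW Wp cW WN]] := trace false.
exists (V `&` W); split => //.
- exact: openI.
- exact: causally_convexI.
- move=> q [Vq Wq]; have [[] [x xq]] := gl_surj G q; rewrite -xq.
    by have [] := VN x; rewrite ?xq.
  by have [] := WN x; rewrite ?xq.
- case=> x [Vx Wx].
    have [_ [S [Sx [sS VS]]]] := VN _ Vx.
    by apply: (small_subset _ sS) (conj Vx Wx) => x' [/VS].
  have [_ [S [Sx [sS WS]]]] := WN _ Wx.
  by apply: (small_subset _ sS) (conj Vx Wx) => x' [_ /WS].
Qed.

Lemma cvg_iota i (u : nat -> X i) p : (iota \o u) @ \oo --> p ->
  exists2 x, iota x = p & u @ \oo --> x.
Proof.
move=> up; have [[x xp]|nx] := pselect (exists x : X i, iota x = p); last first.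
  have [|n _ h] := up [set p' | forall x : X i, iota x = p' -> set0 x] _.
    by apply: iota_trace => x xp; exfalso; apply: nx; exists x.
  by exfalso; exact: (h n (leqnn n) (u n) erefl).
exists x => // S nS.
have : nbhs p [set p' | forall x : X i, iota x = p' -> S x].
  by apply: iota_trace => x'; rewrite -xp => /(gl_inj G) ->.
by move=> /up[n _ h]; exists n => // m nm; exact: (h m nm).
Qed.

Lemma iota_cvg i (u : nat -> X i) x : u @ \oo --> x ->
  (iota \o u) @ \oo --> iota x.
Proof. by move=> ux N /iota_nbhs/ux. Qed.

(** ** Limits of crossings and local properties *)

Section SmallConvex.
Context (V : set Y) (oV : open V) (cV : causally_convex V)
  (sV : forall i, small (@iota i @^-1` V)).

Let W i : set (X i) := @iota i @^-1` V.
Arguments W : clear implicits.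

Lemma open_trace i : open (W i).
Proof.
by rewrite openE => x Vx; apply: iota_nbhs; apply: open_nbhs_nbhs.
Qed.

Lemma convex_trace i : causally_convex (W i).
Proof.
by move=> x y z Vx Vz xy yz; apply: (cV Vx Vz); exact/caus_iota.
Qed.

(** Crossing points cannot escape: convexity keeps them in the relatively
    compact trace of [V], and causal closedness passes to the limit. *)
Lemma crossing_limit i j (u : nat -> X i) (v : nat -> X j) x y a_ b_ :
  (forall n, V (iota (u n))) -> (forall n, V (iota (v n))) ->
  u @ \oo --> x -> v @ \oo --> y ->
  (forall n, iota (a_ n) = iota (b_ n)) ->
  (forall n, caus (X i) (u n) (a_ n)) -> (forall n, caus (X j) (b_ n) (v n)) ->
  exists phi a b, [/\ (forall n : nat, (n <= phi n)%N),
    (a_ \o phi) @ \oo --> a, (b_ \o phi) @ \oo --> b, iota a = iota b &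
    caus (X i) x a /\ caus (X j) b y].
Proof.
move=> Vu Vv ux vy ab ua bv.
have Va n : W i (a_ n).
  apply: (cV (Vu n) (Vv n)); first exact/caus_iota.
  by rewrite ab; exact/caus_iota.
have Vb n : W j (b_ n) by rewrite /W /= -ab; exact: Va.
have [_ _ [K WK cK]] := sV (Va 0%N).
have [a Ka [phi phin ca]] := compact_subseq (PX i) cK (fun n => WK _ (Va n)).
have cb : (iota \o (b_ \o phi)) @ \oo --> iota a.
  by rewrite (_ : _ \o _ = iota \o (a_ \o phi)); [exact: iota_cvg|
    apply/funext => n /=; rewrite ab].
have [b ba {}cb] := cvg_iota cb.
have closed_limit l (w : nat -> X l) z (U : set (X l)) :
    (forall n, U (w n)) -> w @ \oo --> z -> closure U z.
  move=> Uw wz B /wz[n _ nB]; exists (w n); split => //.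
  by apply: nB => /=.
exists phi, a, b; split => //; split.
  have [_ [U WU cU] _] := sV (Va 0%N).
  have Uu n : U ((u \o phi) n) by exact/WU/Vu.
  have Ua n : U ((a_ \o phi) n) by exact/WU/Va.
  have cu := cvg_subseq phin ux.
  apply: (cU (u \o phi) (a_ \o phi)) => //; last 2 first.
  - exact: closed_limit Uu cu.
  - exact: closed_limit Ua ca.
  by move=> n; exact: ua.
have [_ [U WU cU] _] := sV (Vb 0%N).
have Uv n : U ((v \o phi) n) by exact/WU/Vv.
have Ub n : U ((b_ \o phi) n) by exact/WU/Vb.
have cv := cvg_subseq phin vy.
apply: (cU (b_ \o phi) (v \o phi)) => //; last 2 first.
- exact: closed_limit Ub cb.
- exact: closed_limit Uv cv.
by move=> n; exact: bv.
Qed.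

(** Infinitely many [p_ n] lie on one side and infinitely many of the
    corresponding [q_ n] on one side, so the crossings of a subsequence run
    between two fixed sides. *)
Lemma glued_causally_closed : causally_closed V.
Proof.
move=> p_ q_ p q Vp Vq pq cp cq _ _.
have /choice[s sP] : forall n, exists i, exists x : X i, iota x = p_ n.
  by move=> n; exact: gl_surj.
have [i [phi phin sE]] := bool_subseq s.
have /choice[t tP] : forall n, exists j, exists y : X j, iota y = q_ (phi n).
  by move=> n; exact: gl_surj.
have [j [psi psin tE]] := bool_subseq t.
have /choice[u uE] : forall n, exists x : X i, iota x = p_ (phi (psi n)).
  by move=> n; rewrite -(sE (psi n)); exact: sP.
have /choice[v vE] : forall n, exists y : X j, iota y = q_ (phi (psi n)).
  by move=> n; rewrite -(tE n); exact: tP.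
have pn n : (n <= phi (psi n))%N by exact: leq_trans (psin n) (phin _).
have [x xp cu] : exists2 x, iota x = p & u @ \oo --> x.
  apply: cvg_iota; rewrite (_ : _ \o _ = p_ \o (phi \o psi)).
    exact: cvg_subseq.
  by apply/funext => n /=; rewrite uE.
have [y yq cv] : exists2 y, iota y = q & v @ \oo --> y.
  apply: cvg_iota; rewrite (_ : _ \o _ = q_ \o (phi \o psi)).
    exact: cvg_subseq.
  by apply/funext => n /=; rewrite vE.
have /choice[a_ aP] : forall n, exists a : X i, exists b : X j,
    [/\ iota a = iota b, caus (X i) (u n) a & caus (X j) b (v n)].
  by move=> n; apply/(gl_caus G); rewrite uE vE.
have /choice[b_ bP] := aP.
have [|||||_ [a [b [_ _ _ ab [xa yb]]]]] :=
  @crossing_limit i j u v x y a_ b_ _ _ cu cv.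
- by move=> n; rewrite uE.
- by move=> n; rewrite vE.
- by move=> n; have [] := bP n.
- by move=> n; have [] := bP n.
- by move=> n; have [] := bP n.
by rewrite -xp -yq; apply/(gl_caus G); exists a, b.
Qed.

(** Crossings between converging end points have a limit crossing, and there the
    time separations of the sides, being continuous on the traces of [V], cannot
    drop.  With constant sequences this produces an optimal crossing, with
    varying ones upper semicontinuity of the time separation of [Y]. *)
Lemma crossing_usc i j (u : nat -> X i) (v : nat -> X j) x y a_ b_ M :
  (forall n, V (iota (u n))) -> (forall n, V (iota (v n))) ->
  V (iota x) -> V (iota y) ->
  u @ \oo --> x -> v @ \oo --> y ->
  (forall n, iota (a_ n) = iota (b_ n)) ->
  (forall n, caus (X i) (u n) (a_ n)) -> (forall n, caus (X j) (b_ n) (v n)) ->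
  (forall r : R, r%:E < M -> \forall n \near \oo,
     r%:E < tsep (X i) (u n) (a_ n) + tsep (X j) (b_ n) (v n)) ->
  exists a b, [/\ iota a = iota b, caus (X i) x a, caus (X j) b y &
    M <= tsep (X i) x a + tsep (X j) b y].
Proof.
move=> Vu Vv Vx Vy ux vy ab_ ua bv sM.
have [phi [a [b [phin ca cb ab [xa yb]]]]] :=
  crossing_limit Vu Vv ux vy ab_ ua bv.
exists a, b; split => //; rewrite leNgt; apply/negP.
have Va : W i a.
  apply: (cV Vx Vy); first exact/caus_iota.
  by rewrite ab; exact/caus_iota.
have Vb : W j b by rewrite /W /= -ab; exact: Va.
have fa := small_fin (LX i) (convex_trace (i:=i)) (@sV i) Vx Va.
have fb := small_fin (LX j) (convex_trace (i:=j)) (@sV j) Vb Vy.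
move=> sM'; have [r sr rM] : exists2 r : R,
    tsep (X i) x a + tsep (X j) b y < r%:E & r%:E < M.
  move: sM'; rewrite -(fineK fa) -(fineK fb) -EFinD.
  set s := (_ + _)%R; case: M sM => [m| |] // sM.
    by rewrite lte_fin => sm; exists ((s + m) / 2)%R; rewrite lte_fin; lra.
  by move=> _; exists (s + 1)%R; rewrite ?ltry // lte_fin ltrDl.
have [p [q [xap byq pq]]] := gte_add_split fa fb sr.
have ni := small_usc (LX i) (convex_trace (i:=i)) (@sV i)
  (open_trace (i:=i)) Vx Va xap.
have nj := small_usc (LX j) (convex_trace (i:=j)) (@sV j)
  (open_trace (i:=j)) Vb Vy byq.
have ci : (fun n => (u (phi n), a_ (phi n))) @ \oo --> (x, a).
  exact: (cvg_pair (cvg_subseq phin ux) ca).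
have cj : (fun n => (b_ (phi n), v (phi n))) @ \oo --> (b, y).
  exact: (cvg_pair cb (cvg_subseq phin vy)).
have [N1 _ h1] := ci _ ni; have [N2 _ h2] := cj _ nj; have [N3 _ h3] := sM _ rM.
pose n := maxn N1 (maxn N2 N3).
have l1 : (N1 <= n)%N by rewrite leq_maxl.
have l2 : (N2 <= n)%N by rewrite !leq_max leqnn orbT.
have l3 : (N3 <= phi n)%N.
  by apply: leq_trans (phin n); rewrite !leq_max leqnn !orbT.
have /= k1 := h1 n l1; have /= k2 := h2 n l2; have /= k3 := h3 _ l3.
have := lt_trans k3 (lteD k1 k2).
by rewrite -EFinD lte_fin ltNge pq.
Qed.

Lemma best_crossing i j (x : X i) (y : X j) : V (iota x) -> V (iota y) ->
  caus Y (iota x) (iota y) -> exists a b, [/\ iota a = iota b,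
    caus (X i) x a, caus (X j) b y &
    tsep Y (iota x) (iota y) = tsep (X i) x a + tsep (X j) b y].
Proof.
move=> Vx Vy; have := tsep_ge0 PY (iota x) (iota y); rewrite le_eqVlt.
move=> /predU1P[t0|t0].
  move=> /(gl_caus G)[a [b [ab xa yb]]]; exists a, b; split => //.
  apply/eqP; rewrite eq_le (gl_tsep_ge G) // andbT -t0.
  by rewrite adde_ge0 // (tsep_ge0 (PX _)).
have [c [c0 cM]] := approx_below t0 => _.
have /choice[a_ aP] : forall n, exists a : X i, exists b : X j,
    [/\ iota a = iota b, caus (X i) x a, caus (X j) b y &
        c n < tsep (X i) x a + tsep (X j) b y].
  by move=> n; have /andP[c0n cn] := c0 n; exact: (gl_tsep_gt G).
have /choice[b_ bP] := aP.
have [||||||a [b [ab xa yb Mab]]] := @crossing_usc i j (fun=> x) (fun=> y)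
  x y a_ b_ (tsep Y (iota x) (iota y)) (fun=> Vx) (fun=> Vy) Vx Vy.
- exact: cvg_cst.
- exact: cvg_cst.
- by move=> n; have [] := bP n.
- by move=> n; have [] := bP n.
- by move=> n; have [] := bP n.
- move=> r /cM; apply: filterS => n rc; apply: lt_trans rc _.
  by have [] := bP n.
exists a, b; split => //; apply/eqP.
by rewrite eq_le Mab (gl_tsep_ge G).
Qed.

Lemma glued_fin p q : V p -> V q -> tsep Y p q \is a fin_num.
Proof.
move=> Vp Vq; have [pq|npq] := pselect (caus Y p q); last first.
  by rewrite (tsep_not_caus PY npq).
have [i [x xp]] := gl_surj G p; have [j [y yq]] := gl_surj G q.
rewrite -xp -yq in Vp Vq pq *.
have [a [b [ab xa yb ->]]] := best_crossing Vp Vq pq.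
have Va : W i a.
  apply: (cV Vp Vq); first exact/caus_iota.
  by rewrite ab; exact/caus_iota.
have Vb : W j b by rewrite /W /= -ab; exact: Va.
have fa := small_fin (LX i) (convex_trace (i:=i)) (@sV i) Vp Va.
have fb := small_fin (LX j) (convex_trace (i:=j)) (@sV j) Vb Vq.
by rewrite fin_numD fa fb.
Qed.

Lemma glued_usc p q (c : R) : V p -> V q -> tsep Y p q < c%:E ->
  \forall p' \near p & q' \near q, tsep Y p' q' < c%:E.
Proof.
move=> Vp Vq pqc.
apply: (near_iota2 (P := fun p' q' => tsep Y p' q' < c%:E)) => i j x y xp yq.
rewrite /= in xp yq; rewrite -xp -yq in Vp Vq pqc.
suff : \forall z \near (x, y), V (iota z.1) -> V (iota z.2) ->
    tsep Y (iota z.1) (iota z.2) < c%:E.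
  move=> h.
  have hV : \forall z \near (x, y), V (iota z.1) /\ V (iota z.2).
    exists (W i, W j) => //=; split;
      by apply: open_nbhs_nbhs; split => //; exact: open_trace.
  by apply: filterS2 hV h => z [V1 V2]; apply.
apply: contrapT => /(not_near_seq (PX i) (PX j))[u [v [ux vy uv]]].
have Vu n : V (iota (u n)) by apply: contrapT => h; apply: (uv n) => /=.
have Vv n : V (iota (v n)) by apply: contrapT => h; apply: (uv n) => /=.
have {}uv n : c%:E <= tsep Y (iota (u n)) (iota (v n)).
  by rewrite leNgt; apply/negP => h; apply: (uv n).
(* The margin between [c'] and [c] keeps the crossings chosen below strictly
   above the limit value. *)
have [c' c'0 [pqc' cc']] : exists2 c' : R, (0 <= c')%R &
    tsep Y (iota x) (iota y) < c'%:E /\ (c' < c)%R.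
  move: pqc; have := gl_tsep_ge0 G (iota x) (iota y).
  rewrite -(fineK (glued_fin Vp Vq)) lee_fin lte_fin.
  set t := fine _ => t0 tc; exists ((t + c) / 2)%R; first by lra.
  by rewrite lte_fin; split; lra.
have /choice[a_ aP] : forall n, exists a : X i, exists b : X j,
    [/\ iota a = iota b, caus (X i) (u n) a, caus (X j) b (v n) &
        c'%:E < tsep (X i) (u n) a + tsep (X j) b (v n)].
  move=> n; apply: (gl_tsep_gt G); first by rewrite lee_fin.
  by apply: lt_le_trans (uv n); rewrite lte_fin.
have /choice[b_ bP] := aP.
have [||||a [b [ab xa yb Mab]]] := @crossing_usc i j u v
  x y a_ b_ c'%:E Vu Vv Vp Vq ux vy.
- by move=> n; have [] := bP n.
- by move=> n; have [] := bP n.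
- by move=> n; have [] := bP n.
- move=> r rc; near=> n; apply: lt_trans rc _.
  by have [] := bP n.
have := le_lt_trans Mab (le_lt_trans (gl_tsep_ge G ab xa yb) pqc').
by rewrite ltxx.
Unshelve. all: by end_near.
Qed.

(** Extends the length potential of side [i] to all of [Y] as a function that
    never increases along a causal relation and that, between points of the
    trace of [V] on side [i], still drops by at least the distance. *)
Definition side_potential i (p : Y) : \bar R :=
  esup0 [set l | exists x, [/\ W i x, caus Y p (iota x) &
    l = length_potential (W i) x]].

Lemma side_potential_antitone i p q : caus Y p q ->
  side_potential i q <= side_potential i p.
Proof.
move=> pq; apply: esup0_le => [|_ [x [Vx qx ->]]]; first exact: esup0_ge0.
by apply: esup0_ub; exists x; split => //; exact: caus_trans PY _ _ _ pq qx.
Qed.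

Lemma side_potential_drop i (x y : X i) : W i x -> W i y -> caus (X i) x y ->
  ldist (X i) x y + side_potential i (iota y) <= side_potential i (iota x).
Proof.
move=> Vx Vy xy.
have drop := length_potential_drop (LX i) (convex_trace (i:=i)).
apply: (@le_trans _ _ (length_potential (W i) x)); last first.
  by apply: esup0_ub; exists x; split => //; exact: (caus_refl PY).
apply: le_trans (drop _ _ Vx Vy xy); rewrite leeD2l //.
apply: esup0_le => [|_ [z [Vz yz ->]]]; first exact: esup0_ge0.
have {}yz : caus (X i) y z by apply/caus_iota.
apply: le_trans (drop _ _ Vy Vz yz).
by rewrite leeDr // (ldist_ge0 (PX i)).
Qed.

Definition potential p : \bar R :=
  side_potential true p + side_potential false p.

Lemma potential_drop_side i (x y : X i) : W i x -> W i y -> caus (X i) x y ->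
  ldist (X i) x y + potential (iota y) <= potential (iota x).
Proof.
move=> Vx Vy xy; have drop := side_potential_drop Vx Vy xy.
have mono k := side_potential_antitone k (proj2 (caus_iota x y) xy).
rewrite /potential; case: i x y Vx Vy xy drop mono => x y _ _ _ drop mono.
  by rewrite addeA leeD.
by rewrite addeCA leeD.
Qed.

(** A step from one side to the other is split at a crossing point, which lies
    in [V] by convexity. *)
Lemma potential_drop p q : V p -> V q -> caus Y p q ->
  ldist Y p q + potential q <= potential p.
Proof.
have [i [x <-]] := gl_surj G p; have [j [y <-]] := gl_surj G q.
move=> Vx Vy /(gl_caus G)[a [b [ab xa yb]]].
have Va : W i a.
  apply: (cV Vx Vy); first exact/caus_iota.
  by rewrite ab; exact/caus_iota.
have Vb : W j b by rewrite /W /= -ab; exact: Va.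
apply: le_trans (potential_drop_side (Vx : W i x) Va xa).
apply: (@le_trans _ _
  (ldist (X i) x a + (ldist (X j) b y + potential (iota y)))).
  rewrite [leRHS]addeA leeD2r //.
  apply: le_trans (ldist_triangle PY _ (iota a) _) _.
  by rewrite leeD ?(gl_dist G) // ab (gl_dist G).
by rewrite leeD2l // ab; exact: potential_drop_side.
Qed.

Lemma glued_d_length : exists2 C : R, (0 < C)%R & forall a b g,
  causal_curve a b g -> curve_in V a b g -> d_length a b g <= C%:E.
Proof.
have sideC i : exists2 C : R, (0 <= C)%R &
    forall p, side_potential i p <= C%:E.
  have [C C0 CP] := small_d_length (@sV i).
  exists C => // p; apply: esup0_le => [|_ [x [_ _ ->]]].
    by rewrite lee_fin.
  exact: length_potential_le.
have [C C0 CP] := sideC true; have [D D0 DP] := sideC false.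
exists (C + D + 1)%R; first by lra.
move=> a b g [ab _ mg] gV; apply: ge_ereal_sup => _ [s abs <-].
have pot0 p : 0 <= potential p by rewrite adde_ge0 ?esup0_ge0.
apply: (@le_trans _ _ (subdivision_sum (ldist Y) a b g s + potential (g b))).
  by rewrite leeDl.
apply: (@le_trans _ _ (potential (g a))); last first.
  apply: (@le_trans _ _ (C%:E + D%:E)); first by rewrite leeD.
  by rewrite -EFinD lee_fin; lra.
elim: s a {ab} mg gV abs => [|x s ih] a mg gV.
  by move=> /itv_partition_nil ->; rewrite subdivision_sum_nil add0e.
move=> /itv_partition_cons_itv[ax xb xs]; rewrite subdivision_sum_cons.
have aI : a \in `[a, b] by rewrite in_itv /= lexx (le_trans (ltW ax)).
have xI : x \in `[a, b] by rewrite in_itv /= (ltW ax).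
have sub u : u \in `[x, b] -> u \in `[a, b].
  rewrite !in_itv /= => /andP[xu ->]; rewrite andbT.
  exact: le_trans (ltW ax) xu.
apply: le_trans (potential_drop (gV _ aI) (gV _ xI) (mg _ _ aI xI ax)).
rewrite -addeA leeD2l //; apply: ih => //.
  by move=> u v /sub uI /sub vI; exact: mg.
by move=> u /sub/gV.
Qed.

Lemma glued_maximal p q : V p -> V q -> caus Y p q ->
  exists a b g, maximal_in V p q a b g /\ tau_length a b g = tsep Y p q.
Proof.
have [i [x <-]] := gl_surj G p; have [j [y <-]] := gl_surj G q.
move=> Vx Vy /(best_crossing Vx Vy)[a [b [ab xa yb tE]]].
have Va : W i a.
  apply: (cV Vx Vy); first exact/caus_iota.
  by rewrite ab; exact/caus_iota.
have Vb : W j b by rewrite /W /= -ab; exact: Va.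
have [s [t [g [cg lg]]]] :=
  small_maximal (LX i) (convex_trace (i:=i)) (@sV i) Vx Va xa.
have [s' [t' [g' [cg' lg']]]] :=
  small_maximal (LX j) (convex_trace (i:=j)) (@sV j) Vb Vy yb.
have [u [v [k [ck lk]]]] := causal_curve_across ab cg cg'.
have kE : tau_length u v k = tsep Y (iota x) (iota y).
  apply/eqP; rewrite eq_le (tau_length_le_tsep ck) /= tE.
  by move: lk; rewrite lg lg'.
exists u, v, k; split => //; split => //.
  have [c1 ku kv] := ck.
  by apply: (causal_curve_in PY cV _ _ c1); rewrite ?ku ?kv.
by move=> u' v' k' ck' _; rewrite kE; exact: tau_length_le_tsep.
Qed.

(** The local time separation is the restriction of the global one: convexity
    makes the maximal curves of [glued_maximal] run inside [V]. *)
Lemma glued_localizable : localizable_set V.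
Proof.
split; first exact: glued_d_length.
pose w (p q : V) : R := fine (tsep Y (\val p) (\val q)).
have VP (p : V) : V (\val p) by exact: set_valP.
have wE (p q : V) : (w p q)%:E = tsep Y (\val p) (\val q).
  by rewrite /w fineK // glued_fin.
exists w; split.
- by move=> p q; rewrite -lee_fin wE (tsep_ge0 PY).
- move=> [P Q]; apply/cvgrPdist_lt => e e0.
  have h : \forall p \near \val P & q \near \val Q, V p -> V q ->
      (`|w P Q - fine (tsep Y p q)| < e)%R.
    have lo : \forall p \near \val P & q \near \val Q,
        (w P Q - e)%R%:E < tsep Y p q.
      by apply: tsep_near; rewrite // -wE lte_fin; lra.
    have hi : \forall p \near \val P & q \near \val Q,
        tsep Y p q < (w P Q + e)%R%:E.
      by apply: glued_usc => //; rewrite -wE lte_fin; lra.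
    apply: filterS2 lo hi => -[p q] /= lo hi Vp Vq; move: lo hi.
    rewrite -(fineK (glued_fin Vp Vq)) !lte_fin ltr_norml => lo hi.
    by apply/andP; split; lra.
  have cval (p : V) A : nbhs (\val p) A -> nbhs p ((\val : V -> Y) @^-1` A).
    by move=> nA; exact: (@initial_continuous _ _ (\val : V -> Y) p A nA).
  case: h => -[A B] /= [nA nB] AB.
  exists ((\val : V -> Y) @^-1` A, (\val : V -> Y) @^-1` B).
    by split; exact: cval.
  move=> [p q] [/= Ap Bq].
  exact: (AB (\val p, \val q) (conj Ap Bq) (VP p) (VP q)).
- split => /=.
  + by move=> p q; exact: (ldist_ge0 PY).
  + move=> p q; split=> [/(ldist_eq0 PY)/val_inj //|->].
    exact: (ldistxx PY).
  + by move=> p q; exact: (ldist_sym PY).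
  + by move=> p q r; exact: (ldist_triangle PY).
  + by move=> p; exact: (caus_refl PY).
  + by move=> p q r; exact: (caus_trans PY).
  + by move=> p q r; exact: (chron_trans PY).
  + by move=> p q; exact: (chron_caus PY).
  + by move=> p q; rewrite wE (tsep_ge0 PY).
  + move=> [P Q] c /=; rewrite wE => /(tsep_near PY)[[A B] /= [nA nB] AB].
    have rval (p : restriction w) N : nbhs (\val p) N ->
        nbhs p ((\val : V -> Y) @^-1` N).
      rewrite nbhsE => -[B' [oB' B'p] B'N].
      rewrite nbhsE; exists ((\val : V -> Y) @^-1` B'); last first.
        by move=> q /B'N.
      split; last exact: B'p.
      have : @dopen R (restriction w) ((\val : V -> Y) @^-1` B').
        by move=> q /oB'[e e0 eB]; exists e => // r; exact: eB.
      exact.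
    exists [set z | c%:E < (w z.1 z.2)%:E] => //.
    exists ((\val : V -> Y) @^-1` A, (\val : V -> Y) @^-1` B).
      by split; exact: rval.
    move=> [p q] [/= Ap Bq]; rewrite wE.
    exact: (AB (\val p, \val q) (conj Ap Bq)).
  + by move=> p q r; rewrite !wE; exact: (tsep_reverse_triangle PY).
  + by move=> p q; rewrite wE; exact: (tsep_gt0 PY).
- move=> p Vp; have [i [x xp]] := gl_surj G p.
  have nV : nbhs x (W i).
    by apply: iota_nbhs; rewrite xp; exact: open_nbhs_nbhs.
  have [y Vy xy] := lls_future_near (LX i) nV.
  have [z Vz zx] := lls_past_near (LX i) nV.
  split; [exists (iota y)|exists (iota z)]; split => //;
    by rewrite /future /past /= -xp; exact/chron_iota.
- move=> p q pq; have [a [b [g [mg lg]]]] := glued_maximal (VP p) (VP q) pq.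
  by exists a, b, g; split => //; rewrite wE.
Qed.

End SmallConvex.

Theorem glued_length_space :
  lorentzian_length_space Y /\ strongly_localizable Y.
Proof.
have sl : strongly_localizable Y.
  move=> p N /small_convex_nbhs[V [oV Vp cV VN sV]]; exists V; split => //.
    exact: open_nbhs_nbhs.
  exact: glued_localizable.
split => //; split.
- exact: PY.
- move=> p.
  have [V [oV Vp cV _ sV]] := small_convex_nbhs (@filterT _ (nbhs p) _).
  by exists V; [exact: open_nbhs_nbhs|exact: glued_causally_closed].
- exact: glued_path_connected.
- move=> p; have [U [nU _ lU]] := sl p setT (@filterT _ (nbhs p) _).
  by exists U.
- exact: glued_intrinsic.
Qed.

End Gluing.

(** * The amalgam *)

Section Amalgam.
Context {R : realType} (X1 X2 : lorentz_data R) (A1 : set X1) (A2 : set X2).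
Context (f : A1 -> A2).
Context (lls1 : lorentzian_length_space X1)
  (lls2 : lorentzian_length_space X2).
Context (glf : gluing f).

Definition side (i : bool) : lorentz_data R := if i then X1 else X2.

Definition side_inj i : side i -> X1 + X2 :=
  if i as b return (side b -> X1 + X2) then inl else inr.

Definition side_class i (x : side i) : amalgam f :=
  amalgam_class f (side_inj x).

Definition seam i : set (side i) :=
  if i as b return (set (side b)) then A1 else A2.
Arguments seam : clear implicits.

Let LS i : lorentzian_length_space (side i).
Proof. by case: i. Qed.

Let PS i := lls_prelength (LS i).

Lemma glue_map_inv : exists g : A2 -> A1,
  [/\ cancel f g, cancel g f, continuous f & continuous g].
Proof. by have [cf [g [fK gK cg]]] := gluing_homeo glf; exists g. Qed.

Let f_inj : injective f.
Proof. by have [g [fK _ _ _]] := glue_map_inv; exact: can_inj fK. Qed.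

Lemma glueP w w' : Defs.glue f w w' <->
  [\/ w = w', glue_rel f w w' | glue_rel f w' w].
Proof.
split=> [|[->|h|h]]; last 3 first.
- exact: Relation_Operators.rst_refl.
- exact: Relation_Operators.rst_step.
- by apply: Relation_Operators.rst_sym; exact: Relation_Operators.rst_step.
elim=> {w w'} [w w' h|w|w w' _ h|w w' w'' _ h1 _ h2].
- by constructor 2.
- by constructor 1.
- by case: h => h; [constructor 1|constructor 3|constructor 2].
case: h1 => [->//|[a [-> h1]]|[a [h1 ->]]].
  case: h2 => [<-|[b [h2 _]]|[b [-> h2]]].
  - by constructor 2; exists a.
  - by rewrite h1 in h2.
  - by constructor 1; move: h2; rewrite h1 => -[/val_inj/f_inj ->].
case: h2 => [<-|[b [h2 ->]]|[b [_ h2]]].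
- by constructor 3; exists a.
- by constructor 1; move: h2; rewrite h1 => -[/val_inj ->].
- by rewrite h1 in h2.
Qed.

Lemma glue_refl w : Defs.glue f w w.
Proof. exact: Relation_Operators.rst_refl. Qed.

Lemma glue_sym w w' : Defs.glue f w w' -> Defs.glue f w' w.
Proof. exact: Relation_Operators.rst_sym. Qed.

Lemma glue_same_side i (x y : side i) :
  Defs.glue f (side_inj x) (side_inj y) -> x = y.
Proof.
move=> /glueP; case: i x y => x y [[]//|[a []//]|[a []//]].
Qed.

Lemma side_class_glue i j (x : side i) (y : side j) :
  side_class x = side_class y <-> Defs.glue f (side_inj x) (side_inj y).
Proof. exact: amalgam_classP. Qed.

Lemma side_classP (p : amalgam f) : exists i (x : side i), side_class x = p.
Proof.
have : amalgam_class f (amalgam_repr p) = p by rewrite /amalgam_class reprK.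
by case: (amalgam_repr p) => x xp; [exists true, x|exists false, x].
Qed.

Section SumSides.
Implicit Types (w : X1 + X2).

Lemma sum_tsep_ge0 w w' : 0 <= sum_tsep w w'.
Proof.
case: w => x; case: w' => y //=.
  exact: (tsep_ge0 (PS true)).
exact: (tsep_ge0 (PS false)).
Qed.

Lemma sum_dist_ge0 w w' : 0 <= sum_dist w w'.
Proof.
case: w => x; case: w' => y //=; rewrite ?leey //.
  exact: (ldist_ge0 (PS true)).
exact: (ldist_ge0 (PS false)).
Qed.

Lemma sum_caus_refl w : sum_caus w w.
Proof.
case: w => x /=; first exact: (caus_refl (PS true)).
exact: (caus_refl (PS false)).
Qed.

Lemma sum_caus_trans w w' w'' : sum_caus w w' -> sum_caus w' w'' ->
  sum_caus w w'' /\ sum_tsep w w' + sum_tsep w' w'' <= sum_tsep w w''.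
Proof.
case: w => x; case: w' => y //; case: w'' => z //= xy yz.
  split; first exact: (caus_trans (PS true)) xy yz.
  exact: (tsep_reverse_triangle (PS true)) xy yz.
split; first exact: (caus_trans (PS false)) xy yz.
exact: (tsep_reverse_triangle (PS false)) xy yz.
Qed.

Definition crossing w w' (t : \bar R) := exists v v', [/\ Defs.glue f v v',
  sum_caus w v, sum_caus v' w' & t <= sum_tsep w v + sum_tsep v' w'].

(** Entering the seam and leaving it again on the same side is no crossing: the
    relation between the two points of the seam holds on either side. *)
Lemma crossing_glue w w0 w' t :
  Defs.glue f w w0 -> crossing w0 w' t -> crossing w w' t.
Proof.
have direct u u' : sum_caus u u' -> t <= sum_tsep u u' -> crossing u u' t.
  move=> uu' tu; exists u, u; split => //; first exact: glue_refl.
    exact: sum_caus_refl.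
  by apply: le_trans tu _; rewrite leeDr ?sum_tsep_ge0.
have enter u u0 u' : Defs.glue f u u0 -> sum_caus u0 u' ->
    t <= sum_tsep u0 u' -> crossing u u' t.
  move=> uu0 u0u' tu; exists u, u0; split => //; first exact: sum_caus_refl.
  by apply: le_trans tu _; rewrite leeDr ?sum_tsep_ge0.
move=> ww0 [v [v' [vv' w0v v'w' tv]]].
have [E|{}ww0|{}ww0] := (glueP w w0).1 ww0.
- by subst w0; exists v, v'.
- have [E|[b [E _]]|[b [E E']]] := (glueP v v').1 vv'.
  + subst v'; have [w0w' tw'] := sum_caus_trans w0v v'w'.
    by apply: enter w0w' (le_trans tv tw'); apply/glueP; constructor 2.
  + by move: w0v; rewrite E; case: ww0 => a [_ ->].
  + move: ww0 => [a [wE w0E]]; subst w w0 v v'.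
    have ab : caus X1 (\val a) (\val b) by apply/(gluing_caus glf).
    have tE : @sum_tsep R X1 X2 (inr (\val (f a))) (inr (\val (f b))) =
        @sum_tsep R X1 X2 (inl (\val a)) (inl (\val b)).
      by rewrite /= (gluing_tsep glf).
    rewrite tE in tv.
    have abl : @sum_caus _ X1 X2 (inl (\val a)) (inl (\val b)) by [].
    have [aw' taw'] := sum_caus_trans abl v'w'.
    exact: direct aw' (le_trans tv taw').
- have [E|[b [E E']]|[b [_ E]]] := (glueP v v').1 vv'.
  + subst v'; have [w0w' tw'] := sum_caus_trans w0v v'w'.
    by apply: enter w0w' (le_trans tv tw'); apply/glueP; constructor 3.
  + move: ww0 => [a [w0E wE]]; subst w w0 v v'.
    have ab : caus X2 (\val (f a)) (\val (f b)) by apply/(gluing_caus glf).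
    have tE : @sum_tsep R X1 X2 (inl (\val a)) (inl (\val b)) =
        @sum_tsep R X1 X2 (inr (\val (f a))) (inr (\val (f b))).
      by rewrite /= (gluing_tsep glf).
    rewrite tE in tv.
    have abr : @sum_caus _ X1 X2 (inr (\val (f a))) (inr (\val (f b))) by [].
    have [aw' taw'] := sum_caus_trans abr v'w'.
    exact: direct aw' (le_trans tv taw').
  + by move: w0v; rewrite E; case: ww0 => a [-> _].
Qed.

Lemma chain_crossing c w w' : chain (Defs.glue f) (@sum_caus R X1 X2) w w' c ->
  crossing w w' (\sum_(p <- c) sum_tsep p.1 p.2).
Proof.
elim: c w => [|p c ih] w /=.
  move=> ww'; exists w, w'; split; rewrite ?big_nil //.
  - exact: sum_caus_refl.
  - exact: sum_caus_refl.
  - by rewrite adde_ge0 ?sum_tsep_ge0.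
case=> wp pp /ih[v [v' [vv' pv v'w' le]]].
apply: (crossing_glue wp); rewrite big_cons.
have [p1v tv] := sum_caus_trans pp pv.
exists v, v'; split => //.
by apply: le_trans (leeD2l _ le) _; rewrite addeA leeD2r.
Qed.

End SumSides.

Lemma sum_caus_sidel i (x : side i) w : sum_caus (side_inj x) w ->
  exists a : side i, [/\ w = side_inj a, caus (side i) x a &
    sum_tsep (side_inj x) w = tsep (side i) x a].
Proof. by case: i x => x; case: w => // a xa; exists a. Qed.

Lemma sum_caus_sider i (x : side i) w : sum_caus w (side_inj x) ->
  exists a : side i, [/\ w = side_inj a, caus (side i) a x &
    sum_tsep w (side_inj x) = tsep (side i) a x].
Proof. by case: i x => x; case: w => // a xa; exists a. Qed.

Lemma chain_sides i j (x : side i) (y : side j) c :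
  causal_chains f (side_inj x) (side_inj y) c -> exists a b,
  [/\ side_class a = side_class b, caus (side i) x a, caus (side j) b y &
   \sum_(p <- c) sum_tsep p.1 p.2 <= tsep (side i) x a + tsep (side j) b y].
Proof.
move=> [_ /chain_crossing[v [v' [vv' /sum_caus_sidel[a [aE xa ->]]]]]].
move=> /sum_caus_sider[b [bE yb ->]] le; exists a, b; split => //.
by apply/side_class_glue; rewrite -aE -bE.
Qed.

Lemma sides_chain i j (x a : side i) (b y : side j) :
  side_class a = side_class b -> caus (side i) x a -> caus (side j) b y ->
  exists2 c, causal_chains f (side_inj x) (side_inj y) c &
    \sum_(p <- c) sum_tsep p.1 p.2 = tsep (side i) x a + tsep (side j) b y.
Proof.
move=> /side_class_glue ab xa yb.
exists [:: (side_inj x, side_inj a); (side_inj b, side_inj y)].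
  split => //=; split => //; first exact: glue_refl.
    by case: i x a xa {ab}.
  split => //; last exact: glue_refl.
  by case: j b y yb {ab}.
rewrite !big_cons big_nil adde0 /=.
by case: i x a xa {ab} => x a _; case: j b y yb => b y _.
Qed.

Lemma amalgam_caus_sides i j (x : side i) (y : side j) :
  caus (amalgam f) (side_class x) (side_class y) <-> exists a b,
    [/\ side_class a = side_class b, caus (side i) x a & caus (side j) b y].
Proof.
rewrite /side_class amalgam_causE; split.
  by move=> [c /chain_sides[a [b [ab xa yb _]]]]; exists a, b.
by move=> [a [b [ab xa yb]]]; have [c cc _] := sides_chain ab xa yb; exists c.
Qed.

Lemma amalgam_tsep_ge i j (x : side i) (y : side j) a b :
  side_class a = side_class b -> caus (side i) x a -> caus (side j) b y ->
  tsep (side i) x a + tsep (side j) b y <=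
  tsep (amalgam f) (side_class x) (side_class y).
Proof.
move=> ab xa yb; rewrite /side_class amalgam_tsepE.
have [c cc <-] := sides_chain ab xa yb.
by apply: esup0_ub; exists c.
Qed.

Lemma amalgam_tsep_gt i j (x : side i) (y : side j) t : 0 <= t ->
  t < tsep (amalgam f) (side_class x) (side_class y) -> exists a b,
  [/\ side_class a = side_class b, caus (side i) x a, caus (side j) b y &
    t < tsep (side i) x a + tsep (side j) b y].
Proof.
rewrite /side_class amalgam_tsepE => t0 /(esup0_gt t0)[_ [c cc <-] tc].
have [a [b [ab xa yb le]]] := chain_sides cc.
by exists a, b; split => //; exact: lt_le_trans le.
Qed.

Lemma amalgam_dist_ge0 (p q : amalgam f) : 0 <= ldist (amalgam f) p q.
Proof.
apply: le_ereal_inf_tmp => _ [c _ <-]; apply: sume_ge0 => -[w w'] _.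
exact: sum_dist_ge0.
Qed.

Lemma chain_cat (S : Type) (E r : S -> S -> Prop) x y z c c' :
  (forall x y z, E x y -> E y z -> E x z) ->
  chain E r x y c -> c' <> [::] -> chain E r y z c' -> chain E r x z (c ++ c').
Proof.
move=> ET; elim: c x => [|p c ih] x /= => [xy|[xp pp pc]] c'0 yz; last first.
  by split => //; exact: ih.
by case: c' yz c'0 => //= p c' [yp pp pc] _; split => //; exact: ET xy yp.
Qed.

Lemma amalgam_dist_triangle (p q r : amalgam f) :
  ldist (amalgam f) p r <= ldist (amalgam f) p q + ldist (amalgam f) q r.
Proof.
apply: le_inf_add.
- by move=> _ [c _ <-]; apply: sume_ge0 => -[w w'] _; exact: sum_dist_ge0.
- by move=> _ [c _ <-]; apply: sume_ge0 => -[w w'] _; exact: sum_dist_ge0.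
move=> _ _ [c [c0 cc] <-] [c' [c'0 cc'] <-]; apply: ereal_inf_lbound.
exists (c ++ c'); last by rewrite big_cat.
split; first by case: (c) c0.
apply: chain_cat cc c'0 cc'.
exact: Relation_Operators.rst_trans.
Qed.

Lemma chain_rcons (S : Type) (E r : S -> S -> Prop) x y u v z c :
  chain E r x y c -> E y u -> r u v -> E v z ->
  (forall x y z, E x y -> E y z -> E x z) ->
  chain E r x z (rcons c (u, v)).
Proof.
elim: c x => [|p c ih] x /= => [xy|[xp pp pc]] yu uv vz ET.
  by split => //; exact: ET yu.
by split => //; exact: ih.
Qed.

Lemma chain_rev (S : Type) (E : S -> S -> Prop) x y c :
  (forall x, E x x) -> (forall x y, E x y -> E y x) ->
  (forall x y z, E x y -> E y z -> E x z) ->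
  chain E (fun _ _ => True) x y c ->
  chain E (fun _ _ => True) y x (rev [seq (p.2, p.1) | p <- c]).
Proof.
move=> ER ES ET; elim: c x => [|p c ih] x /=; first exact: ES.
move=> [xp _ /ih pc]; rewrite rev_cons.
by apply: chain_rcons pc (ER _) I _ ET; exact: ES.
Qed.

Lemma amalgam_dist_sym (p q : amalgam f) :
  ldist (amalgam f) p q = ldist (amalgam f) q p.
Proof.
suff le (u v : amalgam f) :
    ldist (amalgam f) u v <= ldist (amalgam f) v u.
  by apply: le_anti; rewrite !le.
apply: le_ereal_inf_tmp => _ [c [c0 cc] <-]; apply: ereal_inf_lbound.
exists (rev [seq (w.2, w.1) | w <- c]).
  split.
    by move=> /(congr1 size); rewrite size_rev size_map; case: (c) c0.
  apply: chain_rev cc; first exact: glue_refl.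
    exact: glue_sym.
  exact: Relation_Operators.rst_trans.
rewrite big_rev big_map; apply: eq_bigr => -[[x|x] [y|y]] _ //=.
  exact: (ldist_sym (PS true)).
exact: (ldist_sym (PS false)).
Qed.

Lemma amalgam_dist_le i (x y : side i) :
  ldist (amalgam f) (side_class x) (side_class y) <= ldist (side i) x y.
Proof.
rewrite /side_class amalgam_distE; apply: ereal_inf_lbound.
exists [:: (side_inj x, side_inj y)].
  by split => //=; split => //; exact: glue_refl.
by rewrite big_cons big_nil adde0; case: i x y.
Qed.

Lemma amalgam_distxx (p : amalgam f) : ldist (amalgam f) p p = 0.
Proof.
have [i [x <-]] := side_classP p.
apply/eqP; rewrite eq_le amalgam_dist_ge0 andbT.
by apply: le_trans (amalgam_dist_le x x) _; rewrite (ldistxx (PS i)).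
Qed.

(** To bound the distance it suffices to follow a quantity along chains whose
    total length stays below [e]. *)
Lemma chain_invariant (J : X1 + X2 -> R -> Prop) (e : R) c w w' t :
  (forall w w' t, (t < e)%R -> Defs.glue f w w' -> J w t -> J w' t) ->
  (forall w w' t d, sum_dist w w' = d%:E -> (0 <= d)%R -> J w t ->
     J w' (t + d)%R) ->
  chain (Defs.glue f) (fun _ _ => True) w w' c ->
  t%:E + \sum_(p <- c) sum_dist p.1 p.2 < e%:E -> J w t ->
  exists2 t', (t' < e)%R & J w' t'.
Proof.
move=> Jg Jd; elim: c w t => [|p c ih] w t /=.
  move=> ww'; rewrite big_nil adde0 lte_fin => te Jw.
  by exists t => //; exact: Jg Jw.
move=> [wp _ pw']; rewrite big_cons => le Jw.
have s0 : 0 <= \sum_(q <- c) sum_dist q.1 q.2.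
  by apply: sume_ge0 => q _; exact: sum_dist_ge0.
have d0 := sum_dist_ge0 p.1 p.2.
case dE : (sum_dist p.1 p.2) d0 le => [d| |] // d0; last first.
  by rewrite addye ?gt_eqF ?(lt_le_trans _ s0) // addey.
rewrite addeA -EFinD => le; rewrite lee_fin in d0.
have te : (t < e)%R.
  rewrite -lte_fin; apply: le_lt_trans le.
  by rewrite -[leLHS]adde0 leeD // lee_fin lerDl.
exact: (ih _ _ pw' le (Jd _ _ _ _ dE d0 (Jg _ _ _ te wp Jw))).
Qed.

Lemma glue_seam i (x : side i) w :
  Defs.glue f (side_inj x) w -> w <> side_inj x -> seam i x.
Proof.
case: i x => x /glueP[->//|[a [E E']]|[a [E E']]] _ /=.
- by case: E => ->; exact: set_valP.
- by [].
- by [].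
- by case: E' => ->; exact: set_valP.
Qed.

Lemma sum_dist_side i (x : side i) w (d : R) :
  sum_dist (side_inj x) w = d%:E ->
  exists2 y : side i, w = side_inj y & ldist (side i) x y = d%:E.
Proof. by case: i x => x; case: w => // y xy; exists y. Qed.

Lemma open_off_seam i : open (~` seam i).
Proof.
by case: i; apply: closed_openC; [exact: (gluing_closed1 glf)|
  exact: (gluing_closed2 glf)].
Qed.

(** To leave its side a chain has to reach the seam, which lies at a positive
    distance because it is closed. *)
Lemma ball_off_seam i (x : side i) (S : set (side i)) :
  ~ seam i x -> nbhs x S ->
  exists2 e : R, (0 < e)%R & forall w, glue_dist f (side_inj x) w < e%:E ->
    exists2 y : side i, w = side_inj y & S y.
Proof.
move=> nx nS.
have : nbhs x (S `&` ~` seam i).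
  apply: filterI nS _; apply: open_nbhs_nbhs.
  by split => //; exact: open_off_seam.
move=> /(nbhs_ldistP (PS i))[e e0 eS]; exists e => // w.
move=> /ereal_inf_lt[_ [c [_ cc] <-] ce].
pose J w t := exists2 y : side i, w = side_inj y & ldist (side i) x y <= t%:E.
have [||||t te [y -> xy]] := @chain_invariant J e c (side_inj x) w 0 _ _ cc.
- move=> w1 w2 t te w12 [y yE xy]; exists y => //.
  have te' : t%:E < e%:E by rewrite lte_fin.
  have [_ ny] := eS y (le_lt_trans xy te').
  subst w1; apply: contrapT => ne; apply: ny.
  exact: glue_seam w12 ne.
- move=> w1 w2 t d w12 d0 [y yE xy]; subst w1.
  have [z -> yz] := sum_dist_side w12; exists z => //.
  apply: le_trans (ldist_triangle (PS i) _ y _) _.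
  by rewrite EFinD leeD // yz.
- by rewrite add0e.
- by exists x => //; rewrite (ldistxx (PS i)).
have te' : t%:E < e%:E by rewrite lte_fin.
by exists y => //; have [] := eS y (le_lt_trans xy te').
Qed.

(** Near a point of the seam a chain may cross many times, but each stretch of
    it inside [X2] between two points of the seam can be replaced, at the cost
    of a factor [L], by a step inside [X1]; so only one factor [L] is lost, and
    not one for each crossing. *)
Lemma ball_on_seam (a0 : A1) (S1 : set X1) (S2 : set X2) :
  nbhs (\val a0) S1 -> nbhs (\val (f a0)) S2 ->
  exists2 e : R, (0 < e)%R & forall w,
    glue_dist f (inl (\val a0)) w < e%:E ->
    match w with inl u => S1 u | inr v => S2 v end.
Proof.
move=> nS1 nS2.
have [U nU [L0 L00 UL0]] := gluing_bilipschitz glf a0.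
pose L := (L0 + 1)%R.
have L1 : (1 <= L)%R by rewrite /L; lra.
have UL x y (d : R) : U x -> U y ->
    (ldist X1 (\val x) (\val y) <= d%:E ->
      ldist X2 (\val (f x)) (\val (f y)) <= (L * d)%:E) /\
    (ldist X2 (\val (f x)) (\val (f y)) <= d%:E ->
      ldist X1 (\val x) (\val y) <= (L * d)%:E).
  move=> Ux Uy; have [l1 l2] := UL0 x y Ux Uy.
  have scale (l l' : \bar R) : 0 <= l -> l' <= L0%:E * l -> l <= d%:E ->
      l' <= (L * d)%:E.
    move=> l0 ll' ld; apply: le_trans ll' _.
    apply: (@le_trans _ _ (L0%:E * d%:E)).
      by rewrite lee_pmul2l ?lte_fin.
    have d0 : (0 <= d)%R by rewrite -lee_fin (le_trans l0).
    by rewrite -EFinM lee_fin ler_wpM2r // /L lerDl.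
  split; apply: scale => //.
    exact: (ldist_ge0 (PS true)).
  exact: (ldist_ge0 (PS false)).
clearbody L.
have [g [fK gK cf cg]] := glue_map_inv.
have nU2 : nbhs (f a0) (g @^-1` U) by apply: cg; rewrite fK.
have [B1 nB1 B1U] := nbhs_set_type nU; have [B2 nB2 B2U] := nbhs_set_type nU2.
have [r1 r10 r1S] := (nbhs_ldistP (PS true) _ _).1 (filterI nS1 nB1).
have [r2 r20 r2S] := (nbhs_ldistP (PS false) _ _).1 (filterI nS2 nB2).
have L20 : (0 < L * L + 1)%R by nra.
pose r := (Num.min r1 r2).
have r0 : (0 < r)%R by rewrite lt_min r10.
have [e e0 eE] : exists2 e : R, (0 < e)%R & (e * (L * L + 1) = r)%R.
  by exists (r / (L * L + 1))%R; rewrite ?divr_gt0 // divfK // gt_eqF.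
have rr1 : (r <= r1)%R by rewrite ge_min lexx.
have rr2 : (r <= r2)%R by rewrite ge_min lexx orbT.
have Lq (q : R) : (0 <= q)%R -> (q <= L * q)%R.
  by move=> q0; rewrite ler_peMl.
have Lt (t : R) : (t < e)%R -> (L * t < L * e)%R.
  by move=> te; rewrite ltr_pM2l //; lra.
have Lmono (t t' : R) : (t <= t')%R -> (L * t <= L * t')%R.
  by move=> tt'; rewrite ler_wpM2l //; lra.
have LLe : (L * (L * e) + e = r)%R by rewrite -eE [RHS]mulrC mulrDl mul1r mulrA.
have Le0 : (0 < L * e)%R by rewrite mulr_gt0 //; lra.
have Le1 := Lq _ (ltW Le0); have Le2 := Lq _ (ltW e0).
(* [J w t] bounds the cost of reaching [w] by a path through the point [a] of
   the seam, in which the way to [a] is measured in [X1] at full price and the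
   rest, on the side of [w], at the price [L]. *)
pose sd a (w : X1 + X2) := match w with
  | inl u => ldist X1 (\val a) u | inr v => ldist X2 (\val (f a)) v end.
pose J w t := exists a s q, [/\ ldist X1 (\val a0) (\val a) <= s%:E,
  sd a w <= q%:E, (0 <= s)%R, (0 <= q)%R & (s + L * q <= L * t)%R].
have Jl u t : (t < e)%R -> J (inl u) t ->
    ldist X1 (\val a0) u < r1%:E.
  move=> te [a [s [q [as_ aq s0 q0 sq]]]].
  apply: le_lt_trans (ldist_triangle (PS true) _ (\val a) _) _.
  apply: le_lt_trans (leeD as_ aq) _; rewrite -EFinD lte_fin.
  by have := Lq _ q0; have := Lt _ te; lra.
have Ja a s (t : R) : ldist X1 (\val a0) (\val a) <= s%:E -> (s <= L * t)%R ->
    (t < e)%R -> U a.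
  move=> as_ st te; apply: B1U; apply: (r1S _ _).2.
  apply: le_lt_trans as_ _; rewrite lte_fin.
  by have := Lt _ te; lra.
have Jr v t : (t < e)%R -> J (inr v) t ->
    ldist X2 (\val (f a0)) v < r2%:E.
  move=> te [a [s [q [as_ aq s0 q0 sq]]]].
  have Ua : U a.
    by apply: (Ja a s t) => //; have := Lq _ q0; lra.
  have Ua0 : U a0 by exact: nbhs_singleton nU.
  apply: le_lt_trans (ldist_triangle (PS false) _ (\val (f a)) _) _.
  apply: le_lt_trans (leeD ((UL _ _ s Ua0 Ua).1 as_) aq) _.
  rewrite -EFinD lte_fin.
  (* s <= L * t and q <= t, so that L * s + q <= (L * L + 1) * t. *)
  have Lq0 : (0 <= L * q)%R by have := Lq _ q0; lra.
  have sLt : (L * s <= L * (L * t))%R by apply: Lmono; lra.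
  have qt : (q <= t)%R by rewrite -(ler_pM2l (lt_le_trans ltr01 L1)); lra.
  have LLt : (L * (L * t) <= L * (L * e))%R by apply/Lmono/ltW/Lt.
  lra.
exists e => // w /ereal_inf_lt[_ [c [_ cc] <-] ce].
have [||||t te Jw] := @chain_invariant J e c (inl (\val a0)) w 0 _ _ cc.
- move=> w1 w2 t te /glueP[->//|[u [-> ->]]|[u [-> ->]]] Jw.
    have [a [s [q [as_ aq s0 q0 sq]]]] := Jw.
    exists u, (s + q)%R, 0%R; split => //.
    + apply: le_trans (ldist_triangle (PS true) _ (\val a) _) _.
      by rewrite EFinD leeD.
    + by rewrite /sd (ldistxx (PS false)).
    + lra.
    + nra.
  have := Jr _ _ te Jw; have [a [s [q [as_ aq s0 q0 sq]]]] := Jw => Jru.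
  have Ua : U a.
    by apply: (Ja a s t) => //; have := Lq _ q0; lra.
  have Uu : U u by have := B2U _ (r2S _ Jru).2; rewrite /= fK.
  exists u, (s + L * q)%R, 0%R; split => //.
  + apply: le_trans (ldist_triangle (PS true) _ (\val a) _) _.
    by rewrite EFinD leeD //; apply: (UL _ _ q Ua Uu).2.
  + by rewrite /sd (ldistxx (PS true)).
  + nra.
  + nra.
- move=> w1 w2 t d w12 d0 [a [s [q [as_ aq s0 q0 sq]]]].
  exists a, s, (q + d)%R; split => //; last 2 first.
  + lra.
  + nra.
  case: w1 w2 w12 aq => [u|u] [v|v] //= uv au.
    apply: le_trans (ldist_triangle (PS true) _ u _) _.
    by rewrite EFinD leeD //= uv.
  apply: le_trans (ldist_triangle (PS false) _ u _) _.
  by rewrite EFinD leeD //= uv.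
- by rewrite add0e.
- exists a0, 0%R, 0%R; split => //; rewrite ?(ldistxx (PS true)) //.
    by rewrite /sd (ldistxx (PS true)).
  lra.
case: w {cc ce} Jw => [u|v] Jw; first by have [] := r1S _ (Jl _ _ te Jw).
by have [] := r2S _ (Jr _ _ te Jw).
Qed.

Lemma amalgam_ball (p : amalgam f) (N : set (amalgam f)) :
  (forall i (x : side i), side_class x = p -> nbhs x (@side_class i @^-1` N)) ->
  exists2 e : R, (0 < e)%R & forall q, ldist (amalgam f) p q < e%:E -> N q.
Proof.
move=> pN; have [i [x xp]] := side_classP p.
suff [e e0 eN] : exists2 e : R, (0 < e)%R & forall w,
    ldist (amalgam f) p (amalgam_class f w) < e%:E -> N (amalgam_class f w).
  exists e => // q; have [j [y <-]] := side_classP q; exact: eN.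
have [Ax|nAx] := pselect (seam i x); last first.
  have [e e0 eN] := ball_off_seam nAx (pN _ _ xp).
  exists e => // w; rewrite -xp /side_class amalgam_distE => /eN[y -> Ny].
  exact: Ny.
have [a aE] : exists a : A1, p = amalgam_class f (inl (\val a)).
  case: i x xp Ax => x xp Ax; first by exists (exist _ x (mem_set Ax)).
  have [g [_ gK _ _]] := glue_map_inv.
  exists (g (exist _ x (mem_set Ax))); rewrite -xp; apply/amalgam_classP.
  apply/glueP; constructor 3.
  by exists (g (exist _ x (mem_set Ax))); rewrite gK.
have aE' : p = amalgam_class f (inr (\val (f a))).
  by rewrite aE; apply/amalgam_classP/glueP; constructor 2; exists a.
have [e e0 eN] := ball_on_seam (pN true _ (esym aE)) (pN false _ (esym aE')).
exists e => // w; rewrite aE amalgam_distE => /eN.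
by case: w.
Qed.

(** Two distinct points are separated because the complement of a point is a
    neighbourhood of the other one in the quotient topology. *)
Lemma amalgam_dist_eq0 (p q : amalgam f) : ldist (amalgam f) p q = 0 <-> p = q.
Proof.
split=> [pq0|->]; last exact: amalgam_distxx.
apply: contrapT => pq.
have [i x xp|e e0 eq] := @amalgam_ball p [set q' | q' <> q].
  have [[y yq]|nq] := pselect (exists y : side i, side_class y = q).
    have yx : 0 < ldist (side i) x y.
      rewrite lt0e (ldist_ge0 (PS i)) andbT; apply/eqP.
      by move=> /(ldist_eq0 (PS i)) E; apply: pq; rewrite -xp -yq E.
    have [d d0 dxy] : exists2 d : R, (0 < d)%R & d%:E <= ldist (side i) x y.
      case: (ldist (side i) x y) yx => [d| |] // d0; first by exists d.
      by exists 1%R; rewrite ?leey.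
    apply: filterS (nbhs_ball (PS i) x d0) => z /= xz zq.
    have /glue_same_side zy : Defs.glue f (side_inj z) (side_inj y).
      by apply/side_class_glue; rewrite yq.
    by move: xz; rewrite zy ltNge dxy.
  by apply: filterS (@filterT _ (nbhs x) _) => z _ zq; apply: nq; exists z.
by apply: (eq q); rewrite ?pq0.
Qed.

(** Off the seam the other side is avoided because the seam is closed; on the
    seam the two sides are compared through the glueing homeomorphism. *)
Lemma amalgam_trace i j (y : side j) (S : set (side i)) :
  (forall x, side_class x = side_class y -> nbhs x S) ->
  nbhs y [set y' | forall x' : side i, side_class x' = side_class y' -> S x'].
Proof.
move=> yS; have [E|ij] := eqVneq i j.
  subst j; apply: filterS (yS _ erefl) => y' Sy' x' /side_class_glue.
  by move=> /glue_same_side ->.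
have [Ay|nAy] := pselect (seam j y); last first.
  have : nbhs y (~` seam j).
    by apply: open_nbhs_nbhs; split => //; exact: open_off_seam.
  apply: filterS => z nz x /side_class_glue/glue_sym xz; exfalso; apply: nz.
  apply: glue_seam xz _; case: (i) (j) ij x z => [] [] //=.
have [g [fK gK cf cg]] := glue_map_inv.
have fclass (a : A1) :
    @side_class true (\val a) = @side_class false (\val (f a)).
  by apply/side_class_glue/glueP; constructor 2; exists a.
have classE (u : side true) (v : side false) : side_class u = side_class v ->
    exists2 a : A1, u = \val a & v = \val (f a).
  by move=> /side_class_glue/glueP[//|[a [[->] [->]]]|[a []//]]; exists a.
case: i j y S yS ij Ay => [] [] //= y S yS _ Ay.
- pose b : A2 := exist _ y (mem_set Ay).
  have nS : nbhs (\val (g b)) S by apply: yS; rewrite fclass gK.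
  have : nbhs b (g @^-1` ((\val : A1 -> X1) @^-1` S)).
    by apply: cg; exact: (@initial_continuous _ _ (\val : A1 -> X1) (g b) S nS).
  move=> /nbhs_set_type[B nB BS]; apply: filterS nB => z Bz x /classE[a xE zE].
  by subst x z; have := BS _ Bz; rewrite /= fK.
- pose a : A1 := exist _ y (mem_set Ay).
  have nS : nbhs (\val (f a)) S by apply: yS; rewrite -fclass.
  have : nbhs a (f @^-1` ((\val : A2 -> X2) @^-1` S)).
    by apply: cf; exact: (@initial_continuous _ _ (\val : A2 -> X2) (f a) S nS).
  move=> /nbhs_set_type[B nB BS].
  apply: filterS nB => z Bz x /esym/classE[b zE xE].
  by subst x z; exact: BS _ Bz.
Qed.

Lemma seam_partner i a : seam i a ->
  forall j, exists b : side j, side_class a = side_class b.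
Proof.
have [g [fK gK _ _]] := glue_map_inv.
case: i a => a Aa [].
- by exists a.
- exists (\val (f (exist _ a (mem_set Aa)))); apply/side_class_glue/glueP.
  by constructor 2; exists (exist _ a (mem_set Aa)).
- exists (\val (g (exist _ a (mem_set Aa)))); apply/side_class_glue/glueP.
  by constructor 3; exists (g (exist _ a (mem_set Aa))); rewrite gK.
- by exists a.
Qed.

Lemma side_class_seam i j (x : side i) (y : side j) : i != j ->
  side_class x = side_class y -> seam i x.
Proof.
move=> ij /side_class_glue xy; apply: glue_seam xy _.
by case: i j ij x y => [] [].
Qed.

Lemma amalgam_future i j (x : side i) (y : side j) (S : set (side i)) :
  side_class x = side_class y -> nbhs x S -> exists a (b : side j),
    [/\ side_class a = side_class b, S a & chron (side i) x a].
Proof.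
move=> xy nS; have [E|ij] := eqVneq i j.
  by subst j; have [a Sa xa] := lls_future_near (LS i) nS; exists a, a.
have Ax := side_class_seam ij xy.
have fx : future x !=set0.
  by have [a _ xa] := lls_future_near (LS i) nS; exists a.
have [a [Sa Aa xa]] : exists a, [/\ S a, seam i a & chron (side i) x a].
  case: i x S nS Ax fx {xy ij} => x S nS Ax fx.
    exact: (gluing_isolating1 glf).1.
  exact: (gluing_isolating2 glf).1.
by have [b ab] := seam_partner Aa j; exists a, b.
Qed.

Lemma amalgam_past i j (x : side i) (y : side j) (S : set (side i)) :
  side_class x = side_class y -> nbhs x S -> exists a (b : side j),
    [/\ side_class a = side_class b, S a & chron (side i) a x].
Proof.
move=> xy nS; have [E|ij] := eqVneq i j.
  by subst j; have [a Sa xa] := lls_past_near (LS i) nS; exists a, a.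
have Ax := side_class_seam ij xy.
have fx : past x !=set0.
  by have [a _ xa] := lls_past_near (LS i) nS; exists a.
have [a [Sa Aa xa]] : exists a, [/\ S a, seam i a & chron (side i) a x].
  case: i x S nS Ax fx {xy ij} => x S nS Ax fx.
    exact: (gluing_isolating1 glf).2.
  exact: (gluing_isolating2 glf).2.
by have [b ab] := seam_partner Aa j; exists a, b.
Qed.

Lemma amalgam_glued : strongly_causal X1 -> strongly_causal X2 ->
  locally_compact [set: X1] -> locally_compact [set: X2] ->
  glued side_class.
Proof.
move=> sc1 sc2 lc1 lc2; split.
- exact: LS.
- by case.
- by case.
- exact: amalgam_dist_ge0.
- exact: amalgam_dist_eq0.
- exact: amalgam_dist_sym.
- exact: amalgam_dist_triangle.
- exact: side_classP.
- by move=> i x y /side_class_glue/glue_same_side.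
- exact: amalgam_dist_le.
- move=> p N pN.
  apply/(nbhs_metricP amalgam_dist_ge0 amalgam_distxx amalgam_dist_triangle).
  exact: amalgam_ball.
- exact: amalgam_trace.
- exact: amalgam_caus_sides.
- by move=> p q; exact: esup0_ge0.
- exact: amalgam_tsep_ge.
- exact: amalgam_tsep_gt.
- by [].
- exact: amalgam_future.
- exact: amalgam_past.
Qed.

End Amalgam.

Theorem theorem1p2 (R : realType) (X1 X2 : lorentz_data R)
    (A1 : set X1) (A2 : set X2) (f : A1 -> A2)
    (lls1 : lorentzian_length_space X1) (lls2 : lorentzian_length_space X2)
    (sc1 : strongly_causal X1) (sc2 : strongly_causal X2)
    (lc1 : locally_compact [set: X1]) (lc2 : locally_compact [set: X2])
    (glf : gluing f) :
  lorentzian_length_space (amalgam f) /\ strongly_localizable (amalgam f).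
Proof.
exact: (glued_length_space (amalgam_glued lls1 lls2 glf sc1 sc2 lc1 lc2)).
Qed.
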